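(* Let $H$ be a Hopf algebra over a field $\Bbbk$ with antipode $\mathcal S$ satisfying $\mathcal S(H_0)\subseteq H_0$. The following are equivalent: (i) $H$ is co-Frobenius. (ii) $H_{[0]}$ is co-Frobenius and $H$ is finitely generated as a left $H_{[0]}$-module. (iii) $H_{[0]}$ is co-Frobenius and the standard filtration is finite, i.e. $H=H_{[m]}$ for some $m$. (iv) The associated graded Hopf algebra $\operatorname{gr}H$ is co-Frobenius. (v) $H_{[0]}$ is co-Frobenius and the diagram $R$ of $H$ is finite dimensional. Moreover, if $H_{[0]}$ is co-Frobenius, then $H_{[0]}=H_0^{\,m}$ (the span of all products of $m$ elements of $H_0$) for some $m\ge0$.
   Context: A left integral for a Hopf algebra $K$ is a linear map $\int:K\to\Bbbk$ with $\int(h_{(2)})h_{(1)}=\int(h)1_K$ for all $h$; $K$ is co-Frobenius if it has a nonzero left integral. For subspaces $D,E$ of a coalgebra, $D\wedge E=\{c:\Delta(c)\in D\otimes C+C\otimes E\}$, $\wedge^0D=D$, $\wedge^{n+1}D=(\wedge^nD)\wedge D$. $H_0$ is the coradical of $H$ (sum of simple subcoalgebras), $H_{[0]}$ is the subalgebra generated by $H_0$ (a Hopf subalgebra), and the standard filtration is $H_{[n]}=\wedge^{n+1}H_{[0]}$; it is a Hopf algebra filtration. $\operatorname{gr}H=\bigoplus_{n\ge0}H_{[n]}/H_{[n-1]}$ ($H_{[-1]}=0$) is the associated graded Hopf algebra, $\pi:\operatorname{gr}H\to H_{[0]}$ is the homogeneous projection, and the diagram is $R=\{x\in\operatorname{gr}H:(\mathrm{id}\otimes\pi)\Delta(x)=x\otimes1\}$,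 a graded Hopf algebra in Yetter–Drinfeld modules over $H_{[0]}$ with $\operatorname{gr}H\cong R\#H_{[0]}$. By convention $H_0^{\,0}=\Bbbk$. *)

(* Defs.v *)
From HB Require Import structures.
From mathcomp Require Import all_boot all_order all_algebra.
Set Implicit Arguments. Unset Strict Implicit. Unset Printing Implicit Defensive.
Import GRing.Theory.
Local Open Scope ring_scope.

Section Hopf.
Variables (k : fieldType) (H : algType k).

Definition lin_fun (f : H -> k) : Prop :=
  forall (a : k) (x y : H), f (a *: x + y) = a * f x + f y.

(* An element of H (x) H is represented by a finite list of simple tensors
   [:: (a_1,b_1); ...] meaning sum_i a_i (x) b_i.  Over a field, H (x) H embeds
   into the bilinear forms on H^* x H^*, so two representations denote the same
   tensor iff they agree on all pairs of linear functionals. *)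
Definition ev2 (f g : H -> k) (r : seq (H * H)) : k :=
  \sum_(p <- r) f p.1 * g p.2.

Definition teq (r1 r2 : seq (H * H)) : Prop :=
  forall f g, lin_fun f -> lin_fun g -> ev2 f g r1 = ev2 f g r2.

Record hopf := Hopf {
  cop : H -> seq (H * H);
  cou : H -> k;
  antip : H -> H;
  cou_lin : lin_fun cou;
  antip_lin : forall (a : k) x y, antip (a *: x + y) = a *: antip x + antip y;
  cop_lin : forall (a : k) x y,
     teq (cop (a *: x + y)) ([seq (a *: p.1, p.2) | p <- cop x] ++ cop y);
  cop_coassoc : forall f g h, lin_fun f -> lin_fun g -> lin_fun h -> forall x,
     \sum_(p <- cop x) ev2 f g (cop p.1) * h p.2
   = \sum_(p <- cop x) f p.1 * ev2 g h (cop p.2);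
  cop_counitl : forall x, \sum_(p <- cop x) cou p.1 *: p.2 = x;
  cop_counitr : forall x, \sum_(p <- cop x) cou p.2 *: p.1 = x;
  cop_mul : forall x y,
     teq (cop (x * y)) [seq (p.1 * q.1, p.2 * q.2) | p <- cop x, q <- cop y];
  cop_one : teq (cop 1) [:: (1, 1)];
  cou_mul : forall x y, cou (x * y) = cou x * cou y;
  cou_one : cou 1 = 1;
  antipl : forall x, \sum_(p <- cop x) antip p.1 * p.2 = cou x *: 1;
  antipr : forall x, \sum_(p <- cop x) p.1 * antip p.2 = cou x *: 1
}.

Variable hH : hopf.

Definition subspace (D : H -> Prop) : Prop :=
  D 0 /\ forall (a : k) x y, D x -> D y -> D (a *: x + y).

Definition subcoalg (D : H -> Prop) : Prop :=
  subspace D /\ forall x, D x ->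
    exists r, teq r (cop hH x) /\ forall p, p \in r -> D p.1 /\ D p.2.

Definition simple_subcoalg (D : H -> Prop) : Prop :=
  subcoalg D /\ (exists x, D x /\ x <> 0) /\
  forall E, subcoalg E -> (forall x, E x -> D x) ->
    (forall x, E x -> x = 0) \/ (forall x, D x -> E x).

Definition coradical (x : H) : Prop :=
  exists s : seq H, (forall y, y \in s -> exists D, simple_subcoalg D /\ D y)
                    /\ x = \sum_(y <- s) y.

Definition H0alg (x : H) : Prop :=
  exists s : seq (k * seq H),
    (forall p, p \in s -> forall y, y \in p.2 -> coradical y)
    /\ x = \sum_(p <- s) p.1 *: \prod_(y <- p.2) y.

Definition corad_pow (m : nat) (x : H) : Prop :=
  exists s : seq (k * seq H),
    (forall p, p \in s -> size p.2 = m /\ forall y, y \in p.2 -> coradical y)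
    /\ x = \sum_(p <- s) p.1 *: \prod_(y <- p.2) y.

Definition wedge (D E : H -> Prop) (c : H) : Prop :=
  exists r, teq r (cop hH c) /\ forall p, p \in r -> D p.1 \/ E p.2.

Fixpoint filt (n : nat) : H -> Prop :=
  match n with
  | 0 => H0alg
  | n'.+1 => wedge (filt n') H0alg
  end.

Definition lower (n : nat) (x : H) : Prop :=
  match n with 0 => x = 0 | n'.+1 => filt n' x end.

(* co-Frobenius for a Hopf subalgebra K (given as a predicate) of H:
   a left integral on K, extended linearly to H (values off K are irrelevant,
   since Delta(K) lies in K (x) K). *)
Definition coFrob_sub (K : H -> Prop) : Prop :=
  exists lam : H -> k, lin_fun lam /\ (exists x, K x /\ lam x <> 0) /\
    forall h, K h -> \sum_(p <- cop hH h) lam p.2 *: p.1 = lam h *: 1.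

Definition coFrobenius : Prop := coFrob_sub (fun _ => True).

Definition fg_left_H0 : Prop :=
  exists s : seq H, forall h, exists c : seq (H * H),
    (forall p, p \in c -> H0alg p.1 /\ p.2 \in s) /\ h = \sum_(p <- c) p.1 * p.2.

Definition filt_finite : Prop := exists m, forall h, filt m h.

(* For h in H_[n], a graded representation of Delta h is a list of triples
   (i, a, b) with i <= n, a in H_[i], b in H_[n-i], and sum a (x) b = Delta h;
   the component of Delta_gr([h]_n) in gr_i (x) gr_(n-i) is sum_{i_t = i} [a_t] (x) [b_t]. *)
Definition grep (n : nat) (h : H) (r : seq (nat * H * H)) : Prop :=
  teq [seq (t.1.2, t.2) | t <- r] (cop hH h) /\
  forall t, t \in r -> (t.1.1 <= n)%N /\ filt t.1.1 t.1.2 /\ filt (n - t.1.1)%N t.2.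

(* A linear functional on gr H is a family lam n of functionals on H_[n]
   vanishing on H_[n-1]; gr H is co-Frobenius iff there is a nonzero such
   family satisfying the left-integral identity (checked on homogeneous elements,
   which suffices by linearity). *)
Definition gr_coFrobenius : Prop :=
  exists lam : nat -> H -> k,
    (forall n, lin_fun (lam n)) /\
    (forall n x, lower n x -> lam n x = 0) /\
    (exists n x, filt n x /\ lam n x <> 0) /\
    forall n h, filt n h -> forall r, grep n h r -> forall i, (i <= n)%N ->
      lower i (\sum_(t <- r | t.1.1 == i) lam (n - i)%N t.2 *: t.1.2
               - (if i == 0%N then lam n h *: 1 else 0)).

(* elements of gr H: finitely supported families g with g n in H_[n];
   g and g' are equal in gr H iff g n - g' n in H_[n-1] for all n. *)
Definition gr_elt (g : nat -> H) : Prop :=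
  (forall n, filt n (g n)) /\ exists N, forall n, (N <= n)%N -> g n = 0.

(* the diagram R = { x in gr H : (id (x) pi) Delta_gr x = x (x) 1 }.
   Degree n part of (id (x) pi) Delta_gr [h]_n is sum_{i_t = n} [a_t]_n (x) b_t in
   gr_n (x) H_[0]; equality in gr_n (x) H_[0] is tested on functionals f on H_[n]/H_[n-1]
   and g on H_[0]. *)
Definition in_diagram (g : nat -> H) : Prop :=
  gr_elt g /\
  forall n r, grep n (g n) r -> forall f f', lin_fun f -> lin_fun f' ->
    (forall x, lower n x -> f x = 0) ->
    \sum_(t <- r | t.1.1 == n) f t.1.2 * f' t.2 = f (g n) * f' 1.

Definition diagram_findim : Prop :=
  exists s : seq (nat -> H),
    (forall i, (i < size s)%N -> in_diagram (nth (fun _ => 0) s i)) /\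
    forall g, in_diagram g -> exists c : nat -> k, forall n,
      lower n (g n - \sum_(i < size s) c i *: nth (fun _ => 0) s i n).

End Hopf.

(* Main.v *)
(* Write [H_[n]] for the standard filtration and, for a functional [f], let
   [L f x = x_1 f(x_2)] and [R f x = f(x_1) x_2].  Everything is expressed with
   functionals on [H], so [gr H] is never constructed.

   The first nonzero restriction of a left integral to the filtration, say to
   [H_[d]], is a homogeneous integral [mu] of [gr H] of degree [d].  For [x] in
   [H_[d]] and [y] in [H_[n]] the identity [y_1 mu(x y_2) = S(x_1) mu(x_2 y)]
   holds in degree [n].  Its right side vanishes for [n > d], which forces
   [H = H_[d]]; applied to [y] in the diagram and [mu(x) = 1] it reads
   [y = S(x_1) mu(x_2 y)], so the diagram is finite dimensional; it also shows
   that [S] is onto, which yields an integral on [H_[0]] and left generators.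
   Conversely, let [lam] be a left integral on [H_[0]] and [m] the last degree.
   For a functional [g] vanishing on [H_[m-1]], [x |-> lam(x_1) g(x_2)] is a left
   integral on [H], and these are not all zero.

   For the last claim choose [t] in [H_0^m] with [lam(t) <> 0].  If [H_0^(m+1)]
   were proper in [H_[0]], a maximal right coideal above it would give a
   functional [f] killing [H_0^(m+1)] with [R f x] in [H_0] and [f x = 1]; but
   then [lam(t) = lam(t (R f x)_1 S((R f x)_2)) = 0]. *)
Require Import Defs.
From HB Require Import structures.
From mathcomp Require Import all_boot all_order all_algebra.
From mathcomp Require Import boolp zify.
From mathcomp Require classical_sets.
Set Implicit Arguments. Unset Strict Implicit. Unset Printing Implicit Defensive.
Import GRing.Theory.
Local Open Scope ring_scope.

(** Bijectivity of the antipode is not among the hypotheses, and this shapes the argument. Each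
    H_[n] / H_[n-1] is a right Hopf module over H_[0], so it is spanned by products of a coinvariant
    and an element of H_[0]; this gives generators on the right only. Since S reverses products and
    maps H_[0] to itself, surjectivity of S turns them into left generators. The same surjectivity
    supplies a coinvariant p such that w |-> mu(w S(p)) is a nonzero integral on H_[0]. No quotient
    is formed: a congruence modulo H_[n-1] is an equality under all functionals killing H_[n-1], and
    membership in a subspace is tested on its annihilator. Contraction by a functional killing
    H_[i-1] maps H_[n] to H_[n-i]; this replaces the graded comultiplication. That the filtration
    exhausts H and that H_0^(m+1) is all of H_[0] rest on one fact: a comodule map to H sends a
    simple comodule into the coradical. Such maps are the [R f], with [f] killing a suitable
    coideal. *)

Section LinearMaps.
Variable k : fieldType.

(** * Linear, bilinear and trilinear maps *)

Definition lin (U V : lmodType k) (f : U -> V) : Prop :=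
  forall (a : k) (x y : U), f (a *: x + y) = a *: f x + f y.

Section Theory.
Variables (U V : lmodType k) (f : U -> V).
Hypothesis linf : lin f.

Lemma lin0 : f 0 = 0.
Proof.
by have := linf (-1) 0 0; rewrite scaler0 addr0 scaleN1r addNr.
Qed.

Lemma linD x y : f (x + y) = f x + f y.
Proof. by have := linf 1 x y; rewrite !scale1r. Qed.

Lemma linZ a x : f (a *: x) = a *: f x.
Proof. by have := linf a x 0; rewrite lin0 !addr0. Qed.

Lemma linN x : f (- x) = - f x.
Proof. by rewrite -!scaleN1r linZ. Qed.

Lemma linB x y : f (x - y) = f x - f y.
Proof. by rewrite linD linN. Qed.

Lemma lin_bigsum (I : Type) (r : seq I) (P : pred I) (F : I -> U) :
  f (\sum_(i <- r | P i) F i) = \sum_(i <- r | P i) f (F i).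
Proof. exact: (big_morph f linD lin0). Qed.

End Theory.

Lemma lin_id (U : lmodType k) : lin (fun u : U => u).
Proof. by []. Qed.

Lemma lin_comp (U V W : lmodType k) (f : V -> W) (g : U -> V) :
  lin f -> lin g -> lin (fun u => f (g u)).
Proof. by move=> lf lg a x y; rewrite lg lf. Qed.

Lemma lin_add (U V : lmodType k) (f g : U -> V) :
  lin f -> lin g -> lin (fun u => f u + g u).
Proof. by move=> lf lg a x y; rewrite lf lg scalerDr addrACA. Qed.

Lemma lin_opp (U V : lmodType k) (f : U -> V) : lin f -> lin (fun u => - f u).
Proof. by move=> lf a x y; rewrite lf opprD scalerN. Qed.

Lemma lin_zero (U V : lmodType k) : lin (fun _ : U => 0 : V).
Proof. by move=> a x y; rewrite scaler0 addr0. Qed.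

Lemma lin_scalel (U V : lmodType k) (c : k) (f : U -> V) :
  lin f -> lin (fun u => c *: f u).
Proof.
by move=> lf a x y; rewrite lf scalerDr !scalerA mulrC.
Qed.

Lemma lin_scaler (U V : lmodType k) (f : U -> k^o) (v : V) :
  lin f -> lin (fun u => (f u : k) *: v).
Proof. by move=> lf a x y; rewrite lf scalerDl -scalerA. Qed.

Lemma lin_kmull (U : lmodType k) (c : k) (f : U -> k^o) :
  lin f -> lin (fun u => (c * f u : k^o)).
Proof. by move=> lf a x y; rewrite lf mulrDr /GRing.scale /= mulrCA. Qed.

Lemma lin_kmulr (U : lmodType k) (c : k) (f : U -> k^o) :
  lin f -> lin (fun u => (f u * c : k^o)).
Proof. by move=> lf a x y; rewrite lf mulrDl /GRing.scale /= mulrA. Qed.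

Lemma lin_sumseq (U V : lmodType k) (I : Type) (r : seq I) (P : pred I)
  (F : U -> I -> V) :
  (forall i, lin (fun u => F u i)) -> lin (fun u => \sum_(i <- r | P i) F u i).
Proof.
move=> lF a x y; rewrite scaler_sumr -big_split /=.
by apply: eq_bigr => i _; rewrite lF.
Qed.

Lemma lin_mull (A : algType k) (U : lmodType k) (c : A) (f : U -> A) :
  lin f -> lin (fun u => c * f u).
Proof. by move=> lf a x y; rewrite lf mulrDr scalerAr. Qed.

Lemma lin_mulr (A : algType k) (U : lmodType k) (c : A) (f : U -> A) :
  lin f -> lin (fun u => f u * c).
Proof. by move=> lf a x y; rewrite lf mulrDl scalerAl. Qed.

Definition bilin (U V W : lmodType k) (B : U -> V -> W) : Prop :=
  (forall b, lin (fun a => B a b)) /\ (forall a, lin (B a)).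

Definition trilin (U V W X : lmodType k) (T : U -> V -> W -> X) : Prop :=
  [/\ forall b c, lin (fun a => T a b c), forall a c, lin (fun b => T a b c)
    & forall a b, lin (fun c => T a b c)].

End LinearMaps.

(** * Complements, annihilators and finite spans *)

Section Subspaces.
Variables (k : fieldType) (H : algType k).
Implicit Types (U K D : H -> Prop) (f g : H -> k).

Lemma sub0 U : subspace U -> U 0.
Proof. by case. Qed.

Lemma subD U x y : subspace U -> U x -> U y -> U (x + y).
Proof. by move=> [_ sU] Ux Uy; have := sU 1 _ _ Ux Uy; rewrite scale1r. Qed.

Lemma subZ U a x : subspace U -> U x -> U (a *: x).
Proof. by move=> [U0 sU] Ux; have := sU a _ _ Ux U0; rewrite addr0. Qed.

Lemma subN U x : subspace U -> U x -> U (- x).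
Proof. by move=> sU Ux; rewrite -scaleN1r; apply: subZ. Qed.

Lemma subB U x y : subspace U -> U x -> U y -> U (x - y).
Proof. by move=> sU Ux Uy; apply: subD => //; apply: subN. Qed.

Lemma sub_sum U (I : eqType) (r : seq I) (P : pred I) (F : I -> H) :
  subspace U -> (forall i, i \in r -> P i -> U (F i)) ->
  U (\sum_(i <- r | P i) F i).
Proof.
move=> sU UF; rewrite big_seq_cond; apply: big_ind.
- exact: sub0.
- by move=> x y; apply: subD.
- by move=> i /andP[ir Pi]; apply: UF.
Qed.

Lemma subspace0 : subspace (fun x : H => x = 0).
Proof. by split=> // a x y -> ->; rewrite scaler0 addr0. Qed.

Lemma subspaceT : subspace (fun _ : H => True).
Proof. by []. Qed.

Lemma subspaceI U K : subspace U -> subspace K -> subspace (fun x => U x /\ K x).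
Proof.
move=> [U0 sU] [K0 sK]; split=> // a x y [Ux Kx] [Uy Ky].
by split; [apply: sU | apply: sK].
Qed.

Section Maximal.
Variables (I : Type) (op : I -> H -> H) (X U : H -> Prop).

Definition opsub D := subspace D /\ forall i x, D x -> D (op i x).

(** Zorn's lemma in a form that serves twice: with no operators it gives complements of subspaces;
    with all [L f] as operators and a line as [X] it gives maximal right coideals. *)
Lemma max_sub : opsub U -> (forall x, U x -> X x -> x = 0) ->
  exists M : H -> Prop, [/\ opsub M, (forall x, U x -> M x),
    (forall x, M x -> X x -> x = 0) &
    forall N : H -> Prop, opsub N -> (forall x, M x -> N x) ->
      (forall x, N x -> X x -> x = 0) -> forall x, N x -> M x].
Proof.
move=> sU UX.
pose good (A : H -> Prop) := [/\ opsub A, (forall x, U x -> A x) &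
  forall x, A x -> X x -> x = 0].
pose P (A : classical_sets.set H) := A = classical_sets.set0 \/ good A.
have [] := @classical_sets.Zorn_bigcup H P.
  move=> F FP Ftot.
  have [[A [FA gA]]|none] := pselect (exists A, F A /\ good A); last first.
    left; apply/classical_sets.seteqP; split=> // x [B FB Bx].
    case: (FP _ FB) => [B0|gB]; first by rewrite B0 in Bx.
    by case: none; exists B.
  have gB B x : F B -> B x -> good B.
    by move=> FB Bx; case: (FP _ FB) => [B0|//]; rewrite B0 in Bx.
  right; split.
  - split.
    + split; first by exists A => //; case: gA => -[[]].
      move=> a x y [B FB Bx] [C FC Cy].
      have [BC|CB] := Ftot _ _ FB FC.
      * have [[[_ sC] _] _ _] := gB _ _ FC Cy.
        by exists C => //; apply: sC => //; apply: BC.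
      * have [[[_ sB] _] _ _] := gB _ _ FB Bx.
        by exists B => //; apply: sB => //; apply: CB.
    + move=> i x [B FB Bx]; have [[_ oB] _ _] := gB _ _ FB Bx.
      by exists B => //; apply: oB.
  - by move=> x Ux; exists A => //; case: gA => _ + _; apply.
  - by move=> x [B FB Bx]; have [_ _] := gB _ _ FB Bx; apply.
move=> M [PM maxM]; case: PM => [M0|[sM UM MX]].
  exfalso; apply: (maxM U); last by right; split.
  split=> [x|e]; first by rewrite M0.
  by have := e _ (sub0 sU.1); rewrite M0.
exists M; split=> // N sN MN NX x Nx; apply: contrapT => nMx.
apply: (maxM N); last by right; split => // y /UM /MN.
by split=> // NM; apply: nMx; apply: NM.
Qed.

End Maximal.

(** A subspace [M] maximal among those containing [U] and meeting [K] in 0 is a complement of [K];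
    [rho] projects onto [K] along it. *)
Lemma proj_along U K : subspace U -> subspace K ->
  (forall x, U x -> K x -> x = 0) ->
  exists rho : H -> H, [/\ lin rho, (forall x, K (rho x)),
    (forall x, K x -> rho x = x) & forall x, U x -> rho x = 0].
Proof.
move=> sU sK UK.
have [||M [[sM _] UM MK maxM]] := @max_sub void (fun _ x => x) K U => //.
have dec x : exists y, K y /\ M (x - y).
  apply: contrapT => no.
  (* [N] is [M] plus the line through [x]. A nonzero element of [K] in it involves [x], and dividing
     by the coefficient gives the [K]-component of [x]. *)
  pose N z := exists a, M (z - a *: x).
  suff Mx : M x by apply: no; exists 0; rewrite subr0; split=> //; apply: sub0.
  apply: (maxM N).
  - split=> //; split.
      by exists 0; rewrite scale0r subr0; apply: sub0.
    move=> a y z [b Mb] [c Mc]; exists (a * b + c).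
    have -> : a *: y + z - (a * b + c) *: x = a *: (y - b *: x) + (z - c *: x).
      by rewrite scalerDl opprD scalerBr scalerA addrACA.
    exact: sM.2.
  - by move=> y My; exists 0; rewrite scale0r subr0.
  - move=> y [a Ma] Ky; have [a0|a0] := eqVneq a 0.
      by apply: MK => //; move: Ma; rewrite a0 scale0r subr0.
    exfalso; apply: no; exists (a^-1 *: y); split; first exact: subZ.
    have -> : x - a^-1 *: y = - a^-1 *: (y - a *: x).
      by rewrite scalerBr !scaleNr scalerA mulVf // scale1r opprK addrC.
    exact: subZ.
  - by exists 1; rewrite scale1r subrr; apply: sub0.
pose rho x := sval (cid (dec x)).
have Krho x : K (rho x) by rewrite /rho; case: cid => ? [].
have Mrho x : M (x - rho x) by rewrite /rho; case: cid => ? [].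
have uniq x y : K y -> M (x - y) -> rho x = y.
  move=> Ky My; apply/eqP; rewrite -subr_eq0; apply/eqP.
  apply: MK; last exact: subB.
  have -> : rho x - y = (x - y) - (x - rho x).
    by rewrite opprB [RHS]addrC addrA subrK.
  exact: subB.
exists rho; split=> //.
- move=> a x y; apply: uniq; first by apply: sK.2.
  have -> : a *: x + y - (a *: rho x + rho y) =
            a *: (x - rho x) + (y - rho y) by rewrite scalerBr opprD addrACA.
  exact: sM.2.
- by move=> x Kx; apply: uniq => //; rewrite subrr; apply: sub0.
- by move=> x Ux; apply: uniq; [apply: sub0 | rewrite subr0; apply: UM].
Qed.

Definition kills f D := forall x, D x -> f x = 0.

Lemma separation U x : subspace U -> ~ U x ->
  exists f, [/\ lin_fun f, kills f U & f x = 1].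
Proof.
move=> sU nUx.
have x0 : x != 0 by apply/eqP => x0; apply: nUx; rewrite x0; apply: sub0.
pose K y := exists c : k, y = c *: x.
have sK : subspace K.
  split; first by exists 0; rewrite scale0r.
  by move=> a _ _ [b ->] [c ->]; exists (a * b + c); rewrite scalerDl scalerA.
have [y Uy [c yE]|rho [lrho Krho idrho Urho]] := proj_along sU sK.
  have [c0|c0] := eqVneq c 0; first by rewrite yE c0 scale0r.
  case: nUx; have -> : x = c^-1 *: y by rewrite yE scalerA mulVf // scale1r.
  exact: subZ.
have injx a b : a *: x = b *: x -> a = b.
  move=> /eqP; rewrite -subr_eq0 -scalerBl scaler_eq0 (negPf x0) orbF subr_eq0.
  by move/eqP.
pose f y := sval (cid (Krho y)).
have fE y : rho y = f y *: x by rewrite /f; case: cid.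
exists f; split.
- move=> a y z; apply: injx.
  by rewrite -fE lrho !fE scalerA -scalerDl.
- by move=> y Uy; apply: injx; rewrite -fE Urho // scale0r.
- by apply: injx; rewrite -fE idrho ?scale1r //; exists 1; rewrite scale1r.
Qed.

(** By [separation] a subspace is its own double annihilator. Membership in a filtration term is
    mostly proved this way. *)
Lemma perp_perp U x : subspace U ->
  (forall f, lin_fun f -> kills f U -> f x = 0) -> U x.
Proof.
move=> sU Ux; apply: contrapT => /(separation sU)[f [lf fU fx]].
by move: (Ux f lf fU) => /eqP; rewrite fx oner_eq0.
Qed.

Lemma functional_eq0 x : (forall f, lin_fun f -> f x = 0) -> x = 0.
Proof. by move=> fx; apply: (perp_perp subspace0) => f lf _; apply: fx. Qed.

Lemma functional_eq x y : (forall f, lin_fun f -> f x = f y) -> x = y.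
Proof.
move=> fxy; apply/eqP; rewrite -subr_eq0; apply/eqP; apply: functional_eq0.
move=> f lf; have /= -> := @linB _ H (k^o) f lf x y.
by rewrite fxy // subrr.
Qed.

(** [B] plus the span of the list. With [B] equal to [lower n] it expresses finite dimension of a
    part of H_[n] / H_[n-1] without a quotient; with [B] zero it is the ordinary span. *)
Fixpoint inspan (B : H -> Prop) (s : seq H) (u : H) : Prop :=
  if s is v :: s0 then exists c : k, inspan B s0 (u - c *: v) else B u.

Lemma inspan_sub B s : subspace B -> subspace (inspan B s).
Proof.
move=> sB; elim: s => [|v s IH] //=; split.
  by exists 0; rewrite scale0r subr0; apply: sub0.
move=> a x y [b Hb] [c Hc]; exists (a * b + c).
have -> : a *: x + y - (a * b + c) *: v = a *: (x - b *: v) + (y - c *: v).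
  by rewrite scalerDl opprD scalerBr scalerA addrACA.
exact: IH.2.
Qed.

Lemma inspan_base B s u : subspace B -> B u -> inspan B s u.
Proof.
move=> sB Bu; elim: s => [|v s IH] //=.
by exists 0; rewrite scale0r subr0.
Qed.

Lemma inspan_mem B s u : subspace B -> u \in s -> inspan B s u.
Proof.
move=> sB; elim: s => [|v s IH] //=; rewrite inE => /orP[/eqP->|us].
  by exists 1; rewrite scale1r subrr; apply: (inspan_base _ sB); apply: sub0.
by exists 0; rewrite scale0r subr0; apply: IH.
Qed.

Lemma inspan_min B s (V : H -> Prop) u : subspace V -> (forall x, B x -> V x) ->
  (forall x, x \in s -> V x) -> inspan B s u -> V u.
Proof.
move=> sV BV; elim: s u => [|v s IH] u sV' /=; first exact: BV.
move=> [c Hc]; rewrite -(subrK (c *: v) u); apply: subD => //.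
  by apply: IH => // x xs; apply: sV'; rewrite inE xs orbT.
by apply: subZ => //; apply: sV'; rewrite mem_head.
Qed.

(** Gaussian elimination, one listed vector at a time. The gain is that the new generators lie in
    [U] itself. *)
Lemma inspan_refine B s U : subspace B -> subspace U ->
  (forall u, U u -> inspan B s u) ->
  exists s' : seq H, (forall x, x \in s' -> U x) /\ forall u, U u -> inspan B s' u.
Proof.
move=> sB; elim: s U => [|v s IH] U sU Us; first by exists [::].
have [||s0 [s0U Us0]] := IH (fun u => U u /\ inspan B s u).
- by apply: subspaceI => //; apply: inspan_sub.
- by move=> u [].
have [all_in|] := pselect (forall u, U u -> inspan B s u).
  by exists s0; split=> [x /s0U[]|u Uu] //; apply: Us0; split=> //; apply: all_in.
move=> /existsNP[u /not_implyP[Uu nu]].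
have [c Hc] := Us _ Uu.
have c0 : c != 0 by apply: contraPneq nu => c0; apply; move: Hc; rewrite c0 scale0r subr0.
exists (u :: s0); split=> [x|w Uw].
  by rewrite inE => /orP[/eqP->|/s0U[]].
have [d Hd] := Us _ Uw.
(* The multiple of [u] that cancels the coefficient of [v]. *)
exists (d / c); apply: Us0; split; first by apply: subB => //; apply: subZ.
have -> : w - (d / c) *: u = (w - d *: v) - (d / c) *: (u - c *: v).
  rewrite scalerBr scalerA divfK // opprB addrA; congr (_ + _).
  by rewrite subrK.
apply: subB => //; first exact: inspan_sub.
by apply: subZ => //; apply: inspan_sub.
Qed.

(** The first listed vector on which [f] is nonzero serves as pivot: later ones are corrected by its
    multiples so as to lie in the kernel of [f], earlier ones lie there already. This is the
    dimension drop in [coideal_filt]. *)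
Lemma inspan_drop s f x : lin_fun f -> inspan (fun x => x = 0) s x -> f x <> 0 ->
  exists s' : seq H, size s = (size s').+1 /\
    forall v, inspan (fun x => x = 0) s v -> f v = 0 ->
      inspan (fun x => x = 0) s' v.
Proof.
move=> lf; have lf' : @lin _ H (k^o) f := lf.
have sB := @inspan_sub (fun x => x = 0) ^~ subspace0.
elim: s x => [|v0 s IH] x /=; first by move=> -> /(_ (lin0 lf')).
have [fv0|fv0] := eqVneq (f v0) 0.
  move=> [c /IH Hc] fx; have [|s' [-> Hs']] := Hc.
    by have /= -> := linB lf' x (c *: v0); have /= -> := linZ lf' c v0;
       rewrite fv0 scaler0 subr0.
  exists (v0 :: s'); split=> // v [d Hd] fv /=; exists d; apply: Hs' => //.
  by have /= -> := linB lf' v (d *: v0); have /= -> := linZ lf' d v0;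
     rewrite fv fv0 scaler0 subr0.
move=> _ _; pose corr w := w - (f w / f v0) *: v0.
exists [seq corr w | w <- s]; split; first by rewrite size_map.
have corr_lin : lin corr.
  move=> a y z; rewrite /corr (lf a y z) mulrDl scalerDl opprD -mulrA.
  by rewrite -scalerA addrACA scalerBr.
have key w : inspan (fun x => x = 0) s w ->
    inspan (fun x => x = 0) [seq corr w | w <- s] (corr w).
  elim: s {IH} w => [|v s IH] w /=; first by move=> ->; rewrite (lin0 corr_lin).
  move=> [c Hc]; exists c.
  by rewrite -(linZ corr_lin) -(linB corr_lin); apply: IH.
move=> v [c Hc] fv; have := key _ Hc.
suff -> : corr (v - c *: v0) = v by [].
rewrite (linB corr_lin) (linZ corr_lin) /corr fv mul0r scale0r subr0.
by rewrite divff // scale1r subrr scaler0 subr0.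
Qed.

End Subspaces.

(** * Tensors as lists: splitting along a subspace and choice of legs *)

Section Tensors.
Variables (k : fieldType) (H : algType k).
Implicit Types (A C D : H -> Prop) (f g : H -> k) (r : seq (H * H)).

(** Equality of tensors against all bilinear maps, the form needed to rewrite Sweedler sums;
    [teq_bteq] derives it from [teq]. *)
Definition bteq r1 r2 := forall (V : lmodType k) (B : H -> H -> V), bilin B ->
  \sum_(p <- r1) B p.1 p.2 = \sum_(p <- r2) B p.1 p.2.

Definition Rr f r : H := \sum_(q <- r) f q.1 *: q.2.
Definition Lr f r : H := \sum_(q <- r) f q.2 *: q.1.

Lemma bilin_Rr f : lin_fun f -> bilin (fun a b : H => f a *: b).
Proof.
move=> lf; split=> [b|a c x y]; first exact: (@lin_scaler k H H f b).
by rewrite scalerDr !scalerA mulrC.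
Qed.

Lemma bilin_Lr f : lin_fun f -> bilin (fun a b : H => f b *: a).
Proof. by move=> lf; have [? ?] := bilin_Rr lf; split. Qed.

Lemma bilin_ev f g : lin_fun f -> lin_fun g ->
  bilin (fun a b : H => (f a * g b : k^o)).
Proof.
by move=> lf lg; split=> c; [apply: lin_kmulr | apply: lin_kmull].
Qed.

Lemma bteq_teq r1 r2 : bteq r1 r2 -> teq r1 r2.
Proof. by move=> e f g lf lg; apply: (e _ _ (bilin_ev lf lg)). Qed.

(** Gaussian elimination modulo [D]: the [a i] are independent modulo [D], with dual functionals
    [F i] killing [D], and [r1] collects the terms whose first leg lies in [D]. *)
Lemma tsplit_dual A C D r : subspace A -> subspace C -> subspace D ->
  (forall p, p \in r -> A p.1 /\ C p.2) ->
  exists r1 (n : nat) (a b : nat -> H) (F : nat -> H -> k),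
  [/\ forall (V : lmodType k) (B : H -> H -> V), bilin B ->
        \sum_(p <- r) B p.1 p.2 =
        \sum_(p <- r1) B p.1 p.2 + \sum_(i < n) B (a i) (b i),
      forall p, p \in r1 -> [/\ A p.1, D p.1 & C p.2],
      forall i, (i < n)%N -> [/\ A (a i), C (b i), lin_fun (F i) & kills (F i) D],
      forall p, p \in r -> D (p.1 - \sum_(i < n) F i p.1 *: a i) &
      forall i j, (i < n)%N -> (j < n)%N -> F i (a j) = (i == j)%:R].
Proof.
move=> sA sC sD; elim: r => [|[a0 b0] r IH] rAC.
  exists [::], 0, (fun _ => 0), (fun _ => 0), (fun _ _ => 0); split=> // V B _.
  by rewrite !big_nil big_ord0 addr0.
have [|r1 [n [a [b [F [rE r1P abP rD Fd]]]]]] := IH.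
  by move=> p pr; apply: rAC; rewrite inE pr orbT.
have /= [Aa0 Cb0] := rAC _ (mem_head _ _).
pose c i := F i a0.
(* What is left of [a0] after removing its [a i] components. If it lies in [D], the components are
   absorbed into the [b i]; otherwise [a0] becomes the last of the dual vectors. *)
pose a1 := a0 - \sum_(i < n) c i *: a i.
have lF i : (i < n)%N -> @lin _ H (k^o) (F i) by move=> /abP[].
have Fa1 i : (i < n)%N -> F i a1 = 0.
  move=> ltin; have /= -> := linB (lF _ ltin) a0 (\sum_(i < n) c i *: a i).
  have /= -> := lin_bigsum (lF _ ltin) (index_enum 'I_n) xpredT (fun i => c i *: a i).
  rewrite (bigD1 (Ordinal ltin)) //= big1 => [|j ji].
    have /= -> := linZ (lF _ ltin) (c i) (a i).
    by rewrite Fd // eqxx /GRing.scale /= mulr1 addr0 subrr.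
  have /= -> := linZ (lF _ ltin) (c j) (a j).
  have -> : F i (a j) = 0; last by rewrite scaler0.
  rewrite Fd //; suff -> : (i == j) = false by [].
  by apply: contraNF ji => /eqP ij; apply/eqP/val_inj.
have Aa1 : A a1.
  apply: subB => //; apply: sub_sum => // i _ _.
  by apply: subZ => //; case: (abP _ (ltn_ord i)).
have [Da1|nDa1] := pselect (D a1).
  exists ((a1, b0) :: r1), n, a, (fun i => b i + c i *: b0), F; split=> //.
  - move=> V B bB; rewrite !big_cons rE //=.
    have -> : B a0 b0 = B a1 b0 + \sum_(i < n) B (a i) (c i *: b0).
      rewrite /a1 (linB (bB.1 b0)) (lin_bigsum (bB.1 b0)).
      rewrite (eq_bigr (fun i : 'I_n => B (a i) (c i *: b0))) ?subrK // => i _.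
      by rewrite (linZ (bB.1 b0)) (linZ (bB.2 (a i))).
    rewrite (eq_bigr _ (fun (i : 'I_n) _ => linD (bB.2 (a i)) (b i) (c i *: b0))).
    by rewrite big_split /= addrACA -!addrA; do 2!congr (_ + _); rewrite addrC.
  - by move=> p; rewrite inE => /orP[/eqP->|/r1P].
  - move=> i ltin; have [? ? ? ?] := abP _ ltin; split=> //.
    by apply: subD => //; apply: subZ.
  - by move=> p; rewrite inE => /orP[/eqP->|/rD].
have [f0 [lf0 f0D f0a1]] := separation sD nDa1.
have lf0' : @lin _ H (k^o) f0 := lf0.
(* [f0] corrected to vanish on every [a j]; it still takes the value 1 at [a1], hence at [a0]. *)
pose f x := f0 x - \sum_(j < n) f0 (a j) * F j x.
have lf : lin_fun f.
  have : @lin _ H (k^o) (fun x => f0 x + - (\sum_(j < n) f0 (a j) * F j x) : k^o).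
    apply: (@lin_add _ H (k^o)) => //; apply: (@lin_opp _ H (k^o)).
    apply: (@lin_sumseq _ H (k^o)) => j; apply: lin_kmull.
    exact: lF (ltn_ord j).
  by [].
have fD : kills f D.
  move=> x Dx; rewrite /f f0D // big1 ?subr0 // => j _.
  by have [_ _ _ ->] := abP _ (ltn_ord j); rewrite ?mulr0.
have fa j : (j < n)%N -> f (a j) = 0.
  move=> ltjn; rewrite /f (bigD1 (Ordinal ltjn)) //= big1 => [|i ij].
    by rewrite Fd // eqxx mulr1 addr0 subrr.
  rewrite Fd //; suff -> : (i == j :> nat) = false by rewrite mulr0.
  by apply: contraNF ij => /eqP ij; apply/eqP/val_inj.
have fa1 : f a1 = 1.
  by rewrite /f f0a1 big1 ?subr0 // => j _; rewrite Fa1 // mulr0.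
have fa0 : f a0 = 1.
  have lf' : @lin _ H (k^o) f := lf.
  rewrite -fa1 /a1; have /= -> := linB lf' a0 (\sum_(i < n) c i *: a i).
  have /= -> := lin_bigsum lf' (index_enum 'I_n) xpredT (fun i => c i *: a i).
  rewrite big1 ?subr0 // => i _; have /= -> := linZ lf' (c i) (a i).
  by rewrite fa // scaler0.
(* The old functionals are corrected by [c i] times [f] so that they vanish on the new vector
   [a0]. *)
exists r1, n.+1, (fun i => if (i < n)%N then a i else a0),
  (fun i => if (i < n)%N then b i else b0),
  (fun i x => if (i < n)%N then F i x - c i * f x else f x); split=> //.
- move=> V B bB; rewrite big_cons rE //= big_ord_recr /= ltnn [LHS]addrC -addrA.
  congr (_ + (_ + _)); apply: eq_bigr => i _.
  by rewrite ltn_ord.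
- move=> i _; case: ifP => ltin //.
  have [? ? lFi Fi] := abP _ ltin; split=> //.
    have : @lin _ H (k^o) (fun x => F i x + - (c i * f x) : k^o).
      apply: (@lin_add _ H (k^o)) => //; apply: (@lin_opp _ H (k^o)).
      exact: lin_kmull.
    by [].
  by move=> x Dx; rewrite Fi // fD // mulr0 subr0.
- move=> p pr; rewrite big_ord_recr /= ltnn.
  under eq_bigr do rewrite ltn_ord scalerBl [c _ * _]mulrC -scalerA.
  rewrite sumrB -scaler_sumr.
  have -> (x A0 C0 : H) (c0 : k) : x - (A0 - c0 *: C0 + c0 *: a0) = (x - A0) - c0 *: (a0 - C0).
    by rewrite opprD opprB scalerBr opprB [_ *: C0 - _]addrC !addrA.
  rewrite -/a1; move: pr; rewrite inE => /orP[/eqP->|pr] /=.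
    by rewrite fa0 scale1r -/a1 subrr; apply: sub0.
  have lf' : @lin _ H (k^o) f := lf.
  suff -> : f p.1 = 0 by rewrite scale0r subr0; apply: rD.
  rewrite -(subrK (\sum_(i < n) F i p.1 *: a i) p.1) (linD lf') fD ?add0r; last exact: rD.
  rewrite (lin_bigsum lf') big1 // => i _.
  by rewrite (linZ lf') fa // scaler0.
- move=> i j; rewrite !ltnS => lein lejn.
  case: (ltnP i n) => ltin; case: (ltnP j n) => ltjn.
  + by rewrite Fd // fa // mulr0 subr0.
  + by rewrite fa0 mulr1 subrr (_ : i == j = false) //; apply/negbTE;
       rewrite neq_ltn (leq_trans ltin).
  + by rewrite fa // (_ : i == j = false) //; apply/negbTE;
       rewrite neq_ltn (leq_trans ltjn) // orbT.
  + have -> : i = n by apply/eqP; rewrite eqn_leq lein.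
    by have -> : j = n; [apply/eqP; rewrite eqn_leq lejn | rewrite fa0 eqxx].
Qed.

(** Contracting with the dual functional [F i] kills [r1] and picks out [b i]. *)
Lemma tsplit_bteq A C D r : subspace A -> subspace C -> subspace D ->
  (forall p, p \in r -> A p.1 /\ C p.2) ->
  exists r1 r2, [/\ bteq r (r1 ++ r2),
    forall p, p \in r1 -> [/\ A p.1, D p.1 & C p.2] &
    forall p, p \in r2 -> [/\ A p.1, C p.2 &
      exists f, [/\ lin_fun f, kills f D & p.2 = Rr f r]]].
Proof.
move=> sA sC sD rAC.
have [r1 [n [a [b [F [rE r1P abP _ Fd]]]]]] := tsplit_dual sA sC sD rAC.
exists r1, [seq (a i, b i) | i : 'I_n]; split=> //.
  move=> V B bB; rewrite rE // big_cat /= big_image /=.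
  by congr (_ + _); apply: eq_bigr.
move=> p /imageP[i _ ->] /=; have [? ? lF FD] := abP _ (ltn_ord i).
split=> //; exists (F i); split=> //.
rewrite /Rr (rE _ _ (bilin_Rr lF)) big_seq big1 => [|p' /r1P[_ /FD -> _]]; last first.
  by rewrite scale0r.
rewrite add0r (bigD1 i) //= big1 => [|j ji].
  by rewrite Fd // eqxx scale1r addr0.
by rewrite Fd // eq_sym (_ : (j : nat) == i = false) ?scale0r //; apply/negbTE.
Qed.

(** Split the formal difference with [D] zero. Each remaining second leg is a contraction of the
    difference, so every functional kills it and it is zero. *)
Lemma teq_bteq r1 r2 : teq r1 r2 -> bteq r1 r2.
Proof.
move=> e V B bB; apply/eqP; rewrite -subr_eq0; apply/eqP.
pose r := r1 ++ [seq (- p.1, p.2) | p <- r2].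
have rE (W : lmodType k) (B' : H -> H -> W) : bilin B' ->
    \sum_(p <- r) B' p.1 p.2 = \sum_(p <- r1) B' p.1 p.2 - \sum_(p <- r2) B' p.1 p.2.
  move=> bB'; rewrite big_cat big_map /= -sumrN; congr (_ + _).
  by apply: eq_bigr => p _; rewrite (linN (bB'.1 p.2)).
rewrite -rE //.
have [|r1' [r2' [-> // r1'0 r2'P]]] :=
    @tsplit_bteq _ _ _ r (subspaceT H) (subspaceT H) (@subspace0 _ H).
  by [].
rewrite big_seq big1 // => p; rewrite mem_cat => /orP[/r1'0[_ -> _]|].
  by rewrite (lin0 (bB.1 p.2)).
move=> /r2'P[_ _ [f [lf _ pE]]].
suff -> : p.2 = 0 by rewrite (lin0 (bB.2 p.1)).
apply: functional_eq0 => g lg; rewrite pE /Rr.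
have lg' : @lin _ H (k^o) g := lg.
have /= -> := lin_bigsum lg' r xpredT (fun q => f q.1 *: q.2).
under eq_bigr do have /= -> := linZ lg' _ _.
have := e f g lf lg; rewrite /ev2 => ee.
have /= -> := rE _ _ (bilin_ev lf lg).
by rewrite [X in X - _]ee subrr.
Qed.

Lemma tsplit A C D r : subspace A -> subspace C -> subspace D ->
  (forall p, p \in r -> A p.1 /\ C p.2) ->
  exists r1 r2, [/\ teq r (r1 ++ r2),
    forall p, p \in r1 -> [/\ A p.1, D p.1 & C p.2] &
    forall p, p \in r2 -> [/\ A p.1, C p.2 &
      exists f, [/\ lin_fun f, kills f D & p.2 = Rr f r]]].
Proof.
move=> sA sC sD /(tsplit_bteq sA sC sD)[r1 [r2 [e r1P r2P]]].
by exists r1, r2; split=> //; apply: bteq_teq.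
Qed.

Lemma teq_sym r1 r2 : teq r1 r2 -> teq r2 r1.
Proof. by move=> e f g lf lg; rewrite e. Qed.

Lemma teq_trans r1 r2 r3 : teq r1 r2 -> teq r2 r3 -> teq r1 r3.
Proof. by move=> e e' f g lf lg; rewrite e ?e'. Qed.

Definition swap r := [seq (p.2, p.1) | p <- r].

Lemma swapK r : swap (swap r) = r.
Proof. by rewrite /swap -map_comp -[RHS]map_id; apply: eq_map => -[]. Qed.

Lemma teq_swap r1 r2 : teq r1 r2 -> teq (swap r1) (swap r2).
Proof.
move=> e f g lf lg; rewrite /ev2 !big_map /=.
under eq_bigr do rewrite mulrC; rewrite [LHS](e g f lg lf) /ev2.
by apply: eq_bigr => p _; rewrite mulrC.
Qed.

Lemma teq_Rr r1 r2 f : lin_fun f -> teq r1 r2 -> Rr f r1 = Rr f r2.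
Proof. by move=> lf /teq_bteq e; apply: (e _ _ (bilin_Rr lf)). Qed.

Lemma teq_Lr r1 r2 f : lin_fun f -> teq r1 r2 -> Lr f r1 = Lr f r2.
Proof. by move=> lf /teq_bteq e; apply: (e _ _ (bilin_Lr lf)). Qed.

Lemma Rr_swap f r : Rr f (swap r) = Lr f r.
Proof. by rewrite /Rr big_map. Qed.

Lemma Lr_swap f r : Lr f (swap r) = Rr f r.
Proof. by rewrite /Lr big_map. Qed.

Lemma tens_adapt0 A r : subspace A -> (forall p, p \in r -> A p.1) ->
  exists r2, teq r r2 /\ forall p, p \in r2 ->
    A p.1 /\ exists f, lin_fun f /\ p.2 = Rr f r.
Proof.
move=> sA rA.
have [p /rA//|r1 [r2 [e r1P r2P]]] := tsplit sA (subspaceT H) (@subspace0 _ H) (r := r).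
exists r2; split.
  apply: teq_trans e _ => f g lf lg; rewrite /ev2 big_cat /= big_seq big1 ?add0r //.
  move=> p /r1P[_ -> _]; have lf' : @lin _ H (k^o) f := lf.
  by have /= -> := lin0 lf'; rewrite mul0r.
by move=> p /r2P[? _ [f [? _ ?]]]; split=> //; exists f.
Qed.

(** Making the first legs independent turns the second legs into contractions of [r], which lie in
    [C]; a second splitting, of the swapped tensor, then turns the first legs into contractions
    too. *)
Lemma tens_adaptL C r : subspace C -> (forall f, lin_fun f -> C (Rr f r)) ->
  exists r', teq r' r /\ forall p, p \in r' ->
    C p.2 /\ exists g, lin_fun g /\ p.1 = Lr g r.
Proof.
move=> sC rC.
have [//|r2 [e2 r2P]] := tens_adapt0 (subspaceT H) (r := r).
have [|r3 [e3 r3P]] := tens_adapt0 sC (r := swap r2).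
  by move=> _ /mapP[q /r2P[_ [f [lf qE]]] ->] /=; rewrite qE; apply: rC.
exists (swap r3); split.
  by apply: teq_sym; apply: teq_trans e2 _; rewrite -[r2]swapK; apply: teq_swap.
move=> _ /mapP[q /r3P[Cq [g [lg qE]]] ->] /=; split=> //.
by exists g; split=> //; rewrite qE Rr_swap; apply: teq_Lr => //; apply: teq_sym.
Qed.

Lemma tens_adaptR C r : subspace C -> (forall f, lin_fun f -> C (Lr f r)) ->
  exists r', teq r' r /\ forall p, p \in r' ->
    C p.1 /\ exists f, lin_fun f /\ p.2 = Rr f r.
Proof.
move=> sC rC; have [f lf|r' [e r'P]] := @tens_adaptL C (swap r) sC.
  by rewrite Rr_swap; apply: rC.
exists (swap r'); split; first by rewrite -[r]swapK; apply: teq_swap.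
move=> _ /mapP[q /r'P[Cq [g [lg qE]]] ->] /=; split=> //.
by exists g; split=> //; rewrite qE Lr_swap.
Qed.

End Tensors.

(** * Sweedler calculus and the antipode as an antimorphism *)

Section Sweedler.
Variables (k : fieldType) (H : algType k) (hH : hopf H).
Implicit Types (f g : H -> k) (V W : lmodType k).

Notation S := (antip hH).
Notation eps := (cou hH).

(** The Sweedler expression B(x_1, x_2); longer Sweedler sums are nested occurrences of [sw]. *)
Definition sw V (B : H -> H -> V) (x : H) : V := \sum_(p <- cop hH x) B p.1 p.2.

Definition Lop f x : H := sw (fun a b => f b *: a) x.
Definition Rop f x : H := sw (fun a b => f a *: b) x.

Lemma sw_teq V (B : H -> H -> V) r x : bilin B -> teq r (cop hH x) ->
  sw B x = \sum_(p <- r) B p.1 p.2.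
Proof. by move=> bB /teq_bteq ->. Qed.

Lemma lin_sw V (B : H -> H -> V) : bilin B -> lin (sw B).
Proof.
move=> bB a x y; rewrite /sw (teq_bteq (cop_lin hH a x y) bB) big_cat big_map.
rewrite scaler_sumr; congr (_ + _); apply: eq_bigr => p _ /=.
exact: (linZ (bB.1 p.2)).
Qed.

Lemma lin_sw_arg V W (B : H -> H -> V) (g : W -> H) :
  bilin B -> lin g -> lin (fun u => sw B (g u)).
Proof. by move=> /lin_sw lB lg; apply: lin_comp. Qed.

Lemma lin_sw_body V W (B : W -> H -> H -> V) x :
  (forall a b, lin (fun u => B u a b)) -> lin (fun u => sw (B u) x).
Proof. by move=> lB; apply: lin_sumseq. Qed.

Lemma lin_antip : lin S.
Proof. exact: antip_lin. Qed.

Lemma lin_eps : lin (eps : H -> k^o).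
Proof. exact: cou_lin. Qed.

Lemma eq_sw V (B B' : H -> H -> V) x : (forall a b, B a b = B' a b) -> sw B x = sw B' x.
Proof. by move=> e; apply: eq_bigr. Qed.

Lemma sw_lin V W (h : V -> W) (B : H -> H -> V) x : lin h ->
  h (sw B x) = sw (fun a b => h (B a b)) x.
Proof. by move=> lh; rewrite /sw (lin_bigsum lh). Qed.

Lemma sw_exchange V (B : H -> H -> H -> H -> V) x y :
  sw (fun a b => sw (B a b) y) x = sw (fun c d => sw (fun a b => B a b c d) x) y.
Proof. exact: exchange_big. Qed.

End Sweedler.

(** Linearity in one slot of a nested Sweedler expression, by following the syntax. The composition
    cases exclude the identity map, on which they would loop. *)
Ltac lin_step :=
  match goal with
  | |- bilin _ => split=> ? /=
  | |- trilin _ => split=> ? ? /=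
  | |- lin (fun u => u) => exact: lin_id
  | |- lin (GRing.mul ?c) => apply: (@lin_mull _ _ _ c (fun u => u))
  | |- lin (GRing.scale ?c) => apply: (@lin_scalel _ _ _ c (fun u => u))
  | |- lin (sw ?hH ?B) => apply: lin_sw
  | |- lin (fun _ => 0) => exact: lin_zero
  | |- lin (fun u => (@GRing.mul ?A (@?g u) ?c : _)) =>
      first [ apply: (@lin_mulr _ _ _ c g) | apply: (@lin_kmulr _ _ c g) ]
  | |- lin (fun u => (@GRing.mul ?A ?c (@?g u))) =>
      first [ apply: (@lin_mull _ _ _ c g) | apply: (@lin_kmull _ _ c g) ]
  | |- lin (fun u => (@?g u) *: ?c) => apply: (@lin_scaler _ _ _ g c)
  | |- lin (fun u => ?c *: (@?g u)) => apply: (@lin_scalel _ _ _ c g)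
  | |- @lin ?k ?U ?V (fun u => sw ?hH (@?B u) ?x) =>
      apply: (@lin_sw_body k _ hH V U B x) => ? ? /=
  | |- @lin ?k ?U ?V (fun u => sw ?hH ?B (@?g u)) =>
      apply: (@lin_sw_arg k _ hH V U B g)
  | |- lin (fun u => antip ?hH (@?g u)) => apply: (lin_comp (lin_antip hH)) => /=
  | |- lin (antip _) => exact: lin_antip
  | |- lin (fun u => cou ?hH (@?g u)) => apply: (lin_comp (lin_eps hH)) => /=
  | |- _ => assumption
  | |- @lin ?k ?U ?W (fun u => ?f (@?g u)) =>
      lazymatch g with
      | (fun u => u) => fail
      | _ => apply: (@lin_comp k U _ W f g)
      end
  | |- @lin ?k ?U ?W (fun u => ?f (@?g u) ?c) =>
      lazymatch g with
      | (fun u => u) => fail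
      | _ => apply: (@lin_comp k U _ W (f ^~ c) g)
      end
  | h : bilin ?f |- lin (?f _) => apply h
  | h : bilin ?f |- lin (?f ^~ _) => apply h
  | h : bilin ?f |- lin (fun a => ?f a _) => apply h
  end.
Ltac lin_tac := repeat lin_step.

Section Sweedler2.
Variables (k : fieldType) (H : algType k) (hH : hopf H).
Implicit Types (f g : H -> k) (V W : lmodType k).

Notation S := (antip hH).
Notation eps := (cou hH).
Notation sw := (sw hH).
Notation L := (Lop hH).
Notation R := (Rop hH).

Lemma lin_Lop f : lin_fun f -> lin (L f).
Proof. by move=> lf; apply: lin_sw; lin_tac. Qed.

Lemma lin_Rop f : lin_fun f -> lin (R f).
Proof. by move=> lf; apply: lin_sw; lin_tac. Qed.

Lemma ev2_sw f g x : ev2 f g (cop hH x) = sw (fun a b => (f a * g b : k^o)) x.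
Proof. by []. Qed.

Lemma f_Lop f g x : lin_fun f -> f (L g x) = ev2 f g (cop hH x).
Proof.
move=> lf; have /= -> := sw_lin hH (fun a b => g b *: a) x (lf : @lin _ H (k^o) f).
rewrite /sw /ev2; apply: eq_bigr => p _; have /= -> := @linZ _ H (k^o) f lf (g p.2) p.1.
exact: mulrC.
Qed.

Lemma f_Rop f g x : lin_fun f -> f (R g x) = ev2 g f (cop hH x).
Proof.
move=> lf; have /= -> := sw_lin hH (fun a b => g a *: b) x (lf : @lin _ H (k^o) f).
rewrite /sw /ev2; apply: eq_bigr => p _; exact: (@linZ _ H (k^o) f lf (g p.1) p.2).
Qed.

(** Expand the first legs in finitely many independent vectors [a i] with dual functionals; each
    coefficient is then a tensor in two factors, to which [teq_bteq] applies. *)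
Lemma teq3 V (T : H -> H -> H -> V) (r : seq (H * seq (H * H))) : trilin T ->
  (forall f g h, lin_fun f -> lin_fun g -> lin_fun h ->
     \sum_(p <- r) f p.1 * ev2 g h p.2 = 0) ->
  \sum_(p <- r) \sum_(q <- p.2) T p.1 q.1 q.2 = 0.
Proof.
move=> [T1 T2 T3] r0.
have step f : lin_fun f -> forall W (B : H -> H -> W), bilin B ->
    \sum_(p <- r) f p.1 *: \sum_(q <- p.2) B q.1 q.2 = 0.
  move=> lf W B bB.
  pose s := [seq (f p.1 *: q.1, q.2) | p <- r, q <- p.2].
  have sE (X : lmodType k) (C : H -> H -> X) : bilin C ->
      \sum_(q <- s) C q.1 q.2 = \sum_(p <- r) f p.1 *: \sum_(q <- p.2) C q.1 q.2.
    move=> bC; rewrite big_allpairs_dep; apply: eq_bigr => p _ /=.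
    rewrite scaler_sumr; apply: eq_bigr => q _; exact: (linZ (bC.1 q.2)).
  rewrite -sE // (@teq_bteq _ _ s [::]) ?big_nil // => g h lg lh.
  rewrite [RHS]big_nil -(r0 f g h) //.
  exact: (sE _ _ (bilin_ev lg lh)).
(* Only the first legs are expanded, hence the dummy second legs 0. *)
have [//|_ [n [a [_ [F [_ _ abP rD _]]]]]] :=
  @tsplit_dual k H _ _ _ [seq (p.1, 0) | p <- r] (subspaceT H) (subspaceT H) (@subspace0 _ H).
have pE p : p \in r -> p.1 = \sum_(i < n) F i p.1 *: a i.
  move=> pr; apply/eqP; rewrite -subr_eq0; apply/eqP.
  by apply: (rD (p.1, 0)); apply/mapP; exists p.
have -> : \sum_(p <- r) \sum_(q <- p.2) T p.1 q.1 q.2 =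
    \sum_(p <- r) \sum_(i < n) F i p.1 *: \sum_(q <- p.2) T (a i) q.1 q.2.
  rewrite big_seq [RHS]big_seq; apply: eq_bigr => p pr; rewrite {1}(pE _ pr).
  under [RHS]eq_bigr do rewrite scaler_sumr.
  rewrite exchange_big /=; apply: eq_bigr => q _; rewrite (lin_bigsum (T1 q.1 q.2)).
  by apply: eq_bigr => i _; rewrite (linZ (T1 q.1 q.2)).
rewrite exchange_big big1 // => i _; apply: step; first by have [] := abP _ (ltn_ord i).
by split=> c.
Qed.

(** The record states coassociativity for triples of functionals; [teq3], applied to the difference
    of the two sides, extends it to all trilinear maps. *)
Lemma sw_coassoc V (T : H -> H -> H -> V) x : trilin T ->
  sw (fun a b => sw (fun c d => T c d b) a) x = sw (fun a b => sw (T a) b) x.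
Proof.
move=> tT; have [T1 T2 T3] := tT; apply/eqP; rewrite -subr_eq0; apply/eqP.
pose r := [seq (q.1, [:: (q.2, p.2)]) | p <- cop hH x, q <- cop hH p.1] ++
  [seq (- p.1, cop hH p.2) | p <- cop hH x].
rewrite -[RHS](@teq3 _ T r) // /sw.
  rewrite big_cat big_allpairs_dep big_map /= -sumrN; congr (_ + _).
    by apply: eq_bigr => p _; apply: eq_bigr => q _; rewrite big_seq1.
  by apply: eq_bigr => p _; rewrite -sumrN; apply: eq_bigr => q _; rewrite (linN (T1 _ _)).
move=> f g h lf lg lh; rewrite /r big_cat big_allpairs_dep big_map /=.
have := cop_coassoc hH lf lg lh x => e.
rewrite (eq_bigr (fun p => ev2 f g (cop hH p.1) * h p.2)) => [|p _]; last first.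
  rewrite /ev2 mulr_suml; apply: eq_bigr => q _.
  by rewrite big_seq1 mulrA.
rewrite e -big_split big1 // => p _ /=.
by have /= -> := linN (lf : @lin _ H (k^o) f) p.1; rewrite mulNr subrr.
Qed.

(** [G] is the context around the surviving leg, so that the counit law applies in the middle of a
    nested sum. The next three lemmas follow the same pattern. *)
Lemma sw_counitl V (G : H -> V) (B : H -> H -> V) x : lin G ->
  (forall a b, B a b = eps a *: G b) -> sw B x = G x.
Proof.
move=> lG BE; rewrite (eq_sw hH x BE) -{2}(cop_counitl hH x) (lin_bigsum lG).
by apply: eq_bigr => p _; rewrite (linZ lG).
Qed.

Lemma sw_counitr V (G : H -> V) (B : H -> H -> V) x : lin G ->
  (forall a b, B a b = eps b *: G a) -> sw B x = G x.
Proof.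
move=> lG BE; rewrite (eq_sw hH x BE) -{2}(cop_counitr hH x) (lin_bigsum lG).
by apply: eq_bigr => p _; rewrite (linZ lG).
Qed.

Lemma sw_antipl V (G : H -> V) (B : H -> H -> V) x : lin G ->
  (forall a b, B a b = G (S a * b)) -> sw B x = eps x *: G 1.
Proof.
by move=> lG BE; rewrite (eq_sw hH x BE) -(linZ lG) -(antipl hH) (lin_bigsum lG).
Qed.

Lemma sw_antipr V (G : H -> V) (B : H -> H -> V) x : lin G ->
  (forall a b, B a b = G (a * S b)) -> sw B x = eps x *: G 1.
Proof.
by move=> lG BE; rewrite (eq_sw hH x BE) -(linZ lG) -(antipr hH) (lin_bigsum lG).
Qed.

Lemma sw_mul V (B : H -> H -> V) x y : bilin B ->
  sw B (x * y) = sw (fun a b => sw (fun c d => B (a * c) (b * d)) y) x.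
Proof. by move=> bB; rewrite /sw (teq_bteq (cop_mul hH x y) bB) big_allpairs_dep. Qed.

Lemma sw_one V (B : H -> H -> V) : bilin B -> sw B 1 = B 1 1.
Proof. by move=> bB; rewrite /sw (teq_bteq (cop_one hH) bB) big_seq1. Qed.

Lemma antip1 : S 1 = 1.
Proof.
have := @sw_antipl _ _ _ 1 (@lin_id k H) (fun _ _ => erefl).
rewrite sw_one; last by lin_tac.
by rewrite mulr1 cou_one scale1r.
Qed.

(* Both sides equal [S(x1 y1) x2 y2 S(y3) S(x3)]. *)
Lemma antipM x y : S (x * y) = S y * S x.
Proof.
pose F a e p c u v := S (a * c) * (e * u) * (S v * S p).
have lF a e p c : bilin (F a e p c) by rewrite /F; lin_tac.
transitivity (sw (fun a b => sw (fun e p => sw (fun c d => sw (F a e p c) d) y) b) x).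
  symmetry; apply: (sw_counitr (G := fun a => S (a * y))) => [|a b]; first by lin_tac.
  rewrite -[S (a * y)]mulr1.
  apply: (sw_antipr (G := fun z => S (a * y) * z)) => [|e p]; first by lin_tac.
  apply: (sw_counitr (G := fun c => S (a * c) * (e * S p))) => [|c d]; first by lin_tac.
  rewrite -[S p in RHS]mul1r.
  apply: (sw_antipr (G := fun z => S (a * c) * (e * (z * S p)))) => [|u v]; first by lin_tac.
  by rewrite /F !mulrA.
rewrite -sw_coassoc; last by rewrite /F; lin_tac.
apply: (sw_counitl (G := fun b => S y * S b)) => [|a b]; first by lin_tac.
transitivity (sw (fun c d => sw (fun e p => sw (fun u v => F e p b u v d) c) a) y).
  rewrite [RHS]sw_exchange; apply: eq_sw => e p.
  by symmetry; apply: (sw_coassoc (T := F e p b)); rewrite /F; lin_tac.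
apply: (sw_counitl (G := fun d => eps a *: (S d * S b))) => [|c d]; first by lin_tac.
pose B z w := S z * w * (S d * S b).
transitivity (sw B (a * c)).
  rewrite sw_mul; last by rewrite /B; lin_tac.
  by apply: eq_sw => e p; apply: eq_sw => u v.
rewrite (sw_antipl (G := fun z => z * (S d * S b))) //; last by lin_tac.
by rewrite cou_mul mul1r mulrC scalerA.
Qed.

Lemma sw_antip V (B : H -> H -> V) x : bilin B ->
  sw B (S x) = sw (fun a b => B (S b) (S a)) x.
Proof.
move=> bB.
(* Both sides equal [B (S(x1)_1 x2 S(x5)) (S(x1)_2 x3 S(x4))]. *)
pose G c p q := sw (fun s t => B (p * S t) (q * S s)) c.
pose T a b c := sw (G c) (S a * b).
have lT : trilin T.
  rewrite /T /G; lin_tac.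
have lG c : bilin (G c) by rewrite /G; lin_tac.
transitivity (sw (fun z c => sw (fun a b => T a b c) z) x); last first.
  transitivity (G x 1 1); last by apply: eq_sw => a b; rewrite !mul1r.
  apply: (sw_counitl (G := fun c => G c 1 1)) => [|z c] /=; last first.
    rewrite -(sw_one (lG c)).
    by apply: (sw_antipl (G := sw (G c))) => //; apply: lin_sw.
  by rewrite /G; lin_tac.
rewrite (sw_coassoc x lT).
symmetry; apply: (sw_counitr (G := fun a => sw B (S a))) => [|a y] /=; first by lin_tac.
transitivity (sw (fun u v => sw (fun b c => sw (fun d e => sw (fun s t =>
  B (u * d * S t) (v * e * S s)) c) b) y) (S a)).
  rewrite sw_exchange; apply: eq_sw => b c.
  by rewrite /T sw_mul.
rewrite (sw_lin hH B (S a) (lin_scalel (eps y) (@lin_id _ V))).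
apply: eq_sw => u v.
rewrite (sw_coassoc (T := fun d e c => sw (fun s t => B (u * d * S t) (v * e * S s)) c)); last by lin_tac.
rewrite -[u in RHS]mulr1.
apply: (sw_antipr (G := fun z => B (u * z) v)) => [|d z]; first by lin_tac.
rewrite -(sw_coassoc (T := fun e s t => B (u * d * S t) (v * e * S s))); last by lin_tac.
apply: (sw_counitl (G := fun t => B (u * (d * S t)) v)) => [|w t]; first by lin_tac.
rewrite -[v in RHS]mulr1.
by apply: (sw_antipr (G := fun z => B (u * (d * S t)) (v * z))) => [|e s]; [lin_tac | rewrite !mulrA].
Qed.

End Sweedler2.

(** * One-sided contractions, simple comodules and maximal right coideals *)

Section Coalgebra.
Variables (k : fieldType) (H : algType k) (hH : hopf H).
Implicit Types (f g : H -> k) (U D E : H -> Prop).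

Notation eps := (cou hH).
Notation sw := (sw hH).
Notation L := (Lop hH).
Notation R := (Rop hH).
Notation cop := (cop hH).

(** Both sides are f(x_1) g(x_2). Together with [perp_perp] this turns a condition on contractions
    of one leg into a condition on contractions of the other. *)
Lemma LR_adj f g x : lin_fun f -> lin_fun g -> f (L g x) = g (R f x).
Proof. by move=> lf lg; rewrite f_Lop // f_Rop. Qed.

Lemma LR_comm f g x : lin_fun f -> lin_fun g -> L f (R g x) = R g (L f x).
Proof.
move=> lf lg.
have lf' : @lin _ H (k^o) f := lf; have lg' : @lin _ H (k^o) g := lg.
have := @sw_coassoc _ _ hH _ (fun a c d => f d *: (g a *: c)) x.
have -> : L f (R g x) = sw (fun a b => sw (fun c d => f d *: (g a *: c)) b) x.
  rewrite {1}/Rop (sw_lin hH (fun a b => g a *: b) x (lin_Lop hH lf)).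
  apply: eq_sw => a b; rewrite (linZ (lin_Lop hH lf)).
  rewrite (sw_lin hH (fun c d => f d *: c) b (lin_scalel (g a) (@lin_id _ H))).
  by apply: eq_sw => c d; rewrite !scalerA mulrC.
move=> <-; last by lin_tac.
rewrite {1}/Lop (sw_lin hH (fun a b => f b *: a) x (lin_Rop hH lg)).
apply: eq_sw => a b; rewrite (linZ (lin_Rop hH lg)).
by rewrite (sw_lin hH (fun c d => g c *: d) a (lin_scalel (f b) (@lin_id _ H))).
Qed.

Lemma lin_fun_L f g : lin_fun f -> lin_fun g -> lin_fun (fun x => f (L g x)).
Proof.
by move=> lf lg; apply: (@lin_comp _ _ _ _ (f : H -> k^o)) => //; apply: lin_Lop.
Qed.

Lemma lin_fun_R f g : lin_fun f -> lin_fun g -> lin_fun (fun x => f (R g x)).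
Proof.
by move=> lf lg; apply: (@lin_comp _ _ _ _ (f : H -> k^o)) => //; apply: lin_Rop.
Qed.

Lemma L_comp f g x : lin_fun f -> lin_fun g -> L f (L g x) = L (fun z => f (L g z)) x.
Proof.
move=> lf lg; apply: functional_eq => h lh.
have lfg := lin_fun_L lf lg.
by rewrite [LHS]LR_adj // -LR_comm // [RHS]LR_adj.
Qed.

Lemma R_comp f g x : lin_fun f -> lin_fun g -> R f (R g x) = R (fun z => f (R g z)) x.
Proof.
move=> lf lg; apply: functional_eq => h lh.
have lfg := lin_fun_R lf lg.
by rewrite -[LHS]LR_adj // LR_comm // -[RHS]LR_adj.
Qed.

Lemma lin_fun_eps : lin_fun eps. Proof. exact: cou_lin. Qed.

Lemma L_eps x : L eps x = x.
Proof. exact: (cop_counitr hH). Qed.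

Lemma R_eps x : R eps x = x.
Proof. exact: (cop_counitl hH). Qed.

Lemma eps_L f x : lin_fun f -> eps (L f x) = f x.
Proof. by move=> lf; rewrite (LR_adj x lin_fun_eps lf) R_eps. Qed.

Lemma eps_R f x : lin_fun f -> eps (R f x) = f x.
Proof. by move=> lf; rewrite -(LR_adj x lf lin_fun_eps) L_eps. Qed.

Lemma L_comb a f g x : L (fun z => a * f z + g z) x = a *: L f x + L g x.
Proof.
rewrite /Lop /sw scaler_sumr -big_split; apply: eq_bigr => p _ /=.
by rewrite scalerDl scalerA.
Qed.

Lemma R_comb a f g x : R (fun z => a * f z + g z) x = a *: R f x + R g x.
Proof.
rewrite /Rop /sw scaler_sumr -big_split; apply: eq_bigr => p _ /=.
by rewrite scalerDl scalerA.
Qed.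

Lemma lin_fun_comb a f g : lin_fun f -> lin_fun g -> lin_fun (fun z => a * f z + g z).
Proof.
by move=> lf lg; apply: (@lin_add _ H (k^o)) => //; apply: lin_kmull.
Qed.

Lemma lin_fun_zero : lin_fun (fun _ : H => 0 : k).
Proof. exact: (@lin_zero _ H (k^o)). Qed.

Lemma L_fun0 x : L (fun _ => 0) x = 0.
Proof. by rewrite /Lop /sw big1 // => p _; rewrite scale0r. Qed.

Lemma R_fun0 x : R (fun _ => 0) x = 0.
Proof. by rewrite /Rop /sw big1 // => p _; rewrite scale0r. Qed.

Lemma subcoalg_of_LR U : subspace U ->
  (forall f x, lin_fun f -> U x -> U (L f x)) ->
  (forall f x, lin_fun f -> U x -> U (R f x)) -> subcoalg hH U.
Proof.
move=> sU UL UR; split=> // x Ux.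
have [f lf|r [e rP]] := @tens_adaptL k H U (cop x) sU; first exact: UR.
exists r; split=> // p /rP[Up2 [g [lg ->]]]; split=> //.
exact: UL.
Qed.

Lemma rep_L U r x f : subspace U -> lin_fun f -> teq r (cop x) ->
  (forall p, p \in r -> f p.2 = 0 \/ U p.1) -> U (L f x).
Proof.
move=> sU lf e rU; rewrite [L f x](teq_Lr lf (teq_sym e)).
by apply: sub_sum => // p /rU[->|Up1] _; rewrite ?scale0r; [apply: sub0 | apply: subZ].
Qed.

Lemma rep_R U r x f : subspace U -> lin_fun f -> teq r (cop x) ->
  (forall p, p \in r -> f p.1 = 0 \/ U p.2) -> U (R f x).
Proof.
move=> sU lf e rU; rewrite [R f x](teq_Rr lf (teq_sym e)).
by apply: sub_sum => // p /rU[->|Up1] _; rewrite ?scale0r; [apply: sub0 | apply: subZ].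
Qed.

Lemma subcoalg_L U f x : subcoalg hH U -> lin_fun f -> U x -> U (L f x).
Proof.
move=> [sU UU] lf /UU[r [e rU]]; apply: (rep_L sU lf e) => p /rU[]; by right.
Qed.

Lemma subcoalg_R U f x : subcoalg hH U -> lin_fun f -> U x -> U (R f x).
Proof.
move=> [sU UU] lf /UU[r [e rU]]; apply: (rep_R sU lf e) => p /rU[]; by right.
Qed.

Section SimpleComodule.
Variable u : H.
Hypothesis simple_u : forall f, lin_fun f -> L f u <> 0 ->
  exists g, lin_fun g /\ L g (L f u) = u.
Hypothesis u_neq0 : u <> 0.

Let X y := exists f, lin_fun f /\ y = L f u.

Let sX : subspace X.
Proof.
split; first by exists (fun _ => 0); rewrite L_fun0; split=> //; apply: lin_fun_zero.
move=> a _ _ [f [lf ->]] [g [lg ->]].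
exists (fun z => a * f z + g z); rewrite L_comb; split=> //.
exact: lin_fun_comb.
Qed.

Let XL f y : lin_fun f -> X y -> X (L f y).
Proof.
move=> lf [g [lg ->]]; exists (fun z => f (L g z)); rewrite L_comp //.
by split=> //; apply: lin_fun_L.
Qed.

(** Sums of [n] matrix coefficients of the comodule [X]; the number of terms is recorded because the
    simplicity argument minimises it. *)
Fixpoint coef (n : nat) (x : H) : Prop :=
  if n is n'.+1 then exists g y, [/\ lin_fun g, X y & coef n' (x - R g y)]
  else x = 0.

Let coefD n m x y : coef n x -> coef m y -> coef (n + m) (x + y).
Proof.
elim: n x => [|n IH] x /=; first by move=> ->; rewrite add0r.
move=> [g [z [lg Xz cx]]] cy; exists g, z; split=> //.
by rewrite addrAC; apply: IH.
Qed.

Let coefM n (h : H -> H) x : lin h ->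
  (forall g y, lin_fun g -> X y -> exists g' y', [/\ lin_fun g', X y' & h (R g y) = R g' y']) ->
  coef n x -> coef n (h x).
Proof.
move=> lh hR; elim: n x => [|n IH] x /=; first by move=> ->; apply: lin0.
move=> [g [z [lg Xz cx]]]; have [g' [z' [lg' Xz' e]]] := hR g z lg Xz.
by exists g', z'; split=> //; rewrite -e -(linB lh); apply: IH.
Qed.

Let Dcoef x := exists n, coef n x.

Let sD : subspace Dcoef.
Proof.
split; first by exists 0.
move=> a x y [n cx] [m cy]; exists (n + m)%N; apply: coefD => //.
apply: coefM cx; first by apply: lin_scalel; apply: lin_id.
move=> g z lg Xz; exists g, (a *: z); split=> //; first exact: subZ.
by rewrite (linZ (lin_Rop hH lg)).
Qed.

Let coefL n f x : lin_fun f -> coef n x -> coef n (L f x).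
Proof.
move=> lf; apply: coefM; first exact: lin_Lop.
by move=> g y lg Xy; exists g, (L f y); split=> //; [apply: XL | rewrite LR_comm].
Qed.

Let coefBL n f x : lin_fun f -> coef n x -> coef n (x - L f x).
Proof.
move=> lf; apply: (@coefM n (fun x => x + - L f x)).
  by apply: lin_add; [apply: lin_id | apply/lin_opp/lin_Lop].
move=> g y lg Xy; exists g, (y - L f y); split=> //.
  by apply: subB => //; apply: XL.
by rewrite (linB (lin_Rop hH lg)) LR_comm.
Qed.

Let coefR n f x : lin_fun f -> coef n x -> coef n (R f x).
Proof.
move=> lf; apply: coefM; first exact: lin_Rop.
move=> g y lg Xy; exists (fun z => f (R g z)), y.
by rewrite R_comp //; split=> //; apply: lin_fun_R.
Qed.

Let subcoalgD : subcoalg hH Dcoef.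
Proof.
apply: subcoalg_of_LR => //.
  by move=> f x lf [n cx]; exists n; apply: coefL.
by move=> f x lf [n cx]; exists n; apply: coefR.
Qed.

(* Matrix coefficients of the simple comodule generated by [u] form a subcoalgebra;
   in a nonzero subcoalgebra [E] of it take a nonzero sum of the fewest coefficients
   [R g y]: by minimality [y] is recovered from that sum, so [y] and then everything
   lies in [E]. *)
Lemma simple_coideal_coradical : coradical hH u.
Proof.
have Xu : X u by exists eps; rewrite L_eps; split=> //; apply: lin_fun_eps.
have XD y : X y -> Dcoef y.
  by move=> Xy; exists 1, eps, y; split=> //; [apply: lin_fun_eps | rewrite /= R_eps subrr].
exists [:: u]; rewrite big_seq1; split=> // _ /[!inE] /eqP->; exists Dcoef.
split; last exact: XD.
split=> //; split; first by exists u; split=> //; apply: XD.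
move=> E scE ED.
have [E0|] := pselect (forall x, E x -> x = 0); first by left.
move=> /existsNP[e0 /not_implyP[Ee0 e0n0]]; right.
have ex : exists n, `[< exists e, [/\ E e, e <> 0 & coef n e] >].
  by have [n cn] := ED _ Ee0; exists n; apply/asboolP; exists e0.
case: (ex_minnP ex) => n /asboolP[e [Ee en0 ce]] nmin.
case: n ce nmin => [//|n] /= [g [y [lg Xy ce]]] nmin.
have small e' : E e' -> coef n e' -> e' = 0.
  move=> Ee' ce'; apply: contrapT => e'n0.
  have /nmin : `[< exists e, [/\ E e, e <> 0 & coef n e] >].
    by apply/asboolP; exists e'.
  by rewrite ltnn.
have sE := scE.1.
have yn0 : y <> 0.
  move=> y0; apply: en0; apply: small => //.
  by move: ce; rewrite y0 (lin0 (lin_Rop hH lg)) subr0.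
have Xgen z : X z -> z <> 0 -> forall w, X w -> exists h, lin_fun h /\ w = L h z.
  move=> [f [lf zE]] zn0 w [h [lh ->]].
  have [g' [lg' g'z]] : exists g, lin_fun g /\ L g (L f u) = u.
    by apply: simple_u => //; rewrite -zE.
  exists (fun z => h (L g' z)); split; first exact: lin_fun_L.
  by rewrite -L_comp // zE g'z.
(* If [L h y] were nonzero, some [h2] built from [h] would satisfy L h2 y = y and L h2 e = 0.
   Applying 1 - L h2 to e - R g y then exhibits [e] as a sum of only [n] coefficients, against
   minimality. *)
have key h : lin_fun h -> L h e = 0 -> h y = 0.
  move=> lh he.
  suff hy0 : L h y = 0 by rewrite -eps_L // hy0; apply: (lin0 (lin_fun_eps : @lin _ H (k^o) _)).
  apply: contrapT => hyn0.
  have [h' [lh' yE]] := Xgen _ (XL lh Xy) hyn0 _ Xy.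
  pose h2 z := h' (L h z).
  have lh2 : lin_fun h2 by apply: lin_fun_L.
  have h2y : L h2 y = y by rewrite -L_comp.
  have h2e : L h2 e = 0 by rewrite -L_comp // he (lin0 (lin_Lop hH lh')).
  apply: en0; apply: small => //.
  have := coefBL lh2 ce; rewrite (linB (lin_Lop hH lh2)) h2e LR_comm // h2y sub0r.
  by rewrite opprK subrK.
have Ey : E y.
  have [g' [lg' ->]] : exists g', lin_fun g' /\ y = R g' e; last exact: subcoalg_R.
  pose Y z := exists g', lin_fun g' /\ z = R g' e.
  apply: (@perp_perp k H Y).
    split; first by exists (fun _ => 0); rewrite R_fun0; split=> //; apply: lin_fun_zero.
    move=> a _ _ [f [lf ->]] [f' [lf' ->]].
    by exists (fun z => a * f z + f' z); rewrite R_comb; split=> //; apply: lin_fun_comb.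
  move=> h lh hY; apply: key => //; apply: functional_eq0 => g' lg'.
  by rewrite LR_adj //; apply: hY; exists g'.
have XE z : X z -> E z.
  by move=> /(Xgen _ Xy yn0)[h [lh ->]]; apply: subcoalg_L.
move=> x [m]; elim: m x => [|m IH] x /=; first by move=> ->; apply: sub0.
move=> [h [z [lh Xz /IH Ex]]]; rewrite -(subrK (R h z) x).
by apply: subD => //; apply: subcoalg_R => //; apply: XE.
Qed.

End SimpleComodule.

Lemma simple_coradical u :
  (forall f, lin_fun f -> L f u <> 0 -> exists g, lin_fun g /\ L g (L f u) = u) ->
  coradical hH u.
Proof.
have [->|un0] := pselect (u = 0); last by move=> su; apply: simple_coideal_coradical.
by move=> _; exists [::]; rewrite big_nil.
Qed.

Definition right_coideal U := subspace U /\ forall f x, lin_fun f -> U x -> U (L f x).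

(** Among right coideals above [U] that meet the line through [x] in 0, take a maximal one.
    Adjoining to [M] the coideal of any [c] outside it must capture [x]; so the class of [x]
    generates the smallest nonzero subcomodule of H / M. *)
Lemma max_right_coideal U x : right_coideal U -> ~ U x ->
  exists M, [/\ right_coideal M, forall y, U y -> M y, ~ M x &
    forall c, ~ M c -> exists f, lin_fun f /\ M (x - L f c)].
Proof.
move=> [sU UL] nUx.
pose op (i : {f : H -> k | lin_fun f}) := L (sval i).
pose kx y := exists a : k, y = a *: x.
have opsubP (A : H -> Prop) : opsub op A <-> right_coideal A.
  split=> -[sA Aop]; split=> //.
    by move=> f y lf; apply: (Aop (exist _ f lf)).
  by move=> [f lf] y; apply: Aop.
have [||M [/opsubP[sM ML] UM Mx maxM]] := @max_sub _ H _ op kx U.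
- exact/opsubP.
- move=> y Uy [a yE]; have [a0|a0] := eqVneq a 0; first by rewrite yE a0 scale0r.
  by case: nUx; rewrite -[x]scale1r -(mulVf a0) -scalerA -yE; apply: subZ.
have xn0 : x <> 0 by move=> x0; apply: nUx; rewrite x0; apply: sub0.
exists M; split=> //.
  by move=> Mx'; apply: xn0; apply: Mx => //; exists 1; rewrite scale1r.
move=> c nMc; pose N y := exists f, lin_fun f /\ M (y - L f c).
apply: contrapT => no; apply: nMc; apply: (maxM N); last first.
- by exists eps; rewrite L_eps subrr; split; [apply: lin_fun_eps | apply: sub0].
- move=> y [f [lf Mf]] [a yE]; have [a0|a0] := eqVneq a 0; first by rewrite yE a0 scale0r.
  case: no; exists (fun z => a^-1 * f z + 0); split.
    by apply: lin_fun_comb => //; apply: lin_fun_zero.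
  rewrite L_comb L_fun0 addr0.
  have -> : x - a^-1 *: L f c = a^-1 *: (y - L f c).
    by rewrite scalerBr yE scalerA mulVf // scale1r.
  exact: subZ.
- move=> y My; exists (fun _ => 0); rewrite L_fun0 subr0; split=> //.
  exact: lin_fun_zero.
- apply/opsubP; split.
    split; first by exists (fun _ => 0); rewrite L_fun0 subr0; split;
      [apply: lin_fun_zero | apply: sub0].
    move=> a y z [f [lf Mf]] [g [lg Mg]]; exists (fun w => a * f w + g w).
    split; first exact: lin_fun_comb.
    rewrite L_comb.
    have -> : a *: y + z - (a *: L f c + L g c) = a *: (y - L f c) + (z - L g c).
      by rewrite scalerBr opprD addrACA.
    exact: sM.2.
  move=> g y lg [f [lf Mf]]; exists (fun w => g (L f w)); split; first exact: lin_fun_L.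
  by rewrite -L_comp // -(linB (lin_Lop hH lg)); apply: ML.
Qed.

Lemma coradical_subspace : subspace (coradical hH).
Proof.
split; first by exists [::]; rewrite big_nil.
move=> a _ _ [s [sP ->]] [t [tP ->]].
exists ([seq a *: y | y <- s] ++ t); split; last by rewrite big_cat big_map scaler_sumr.
move=> y; rewrite mem_cat => /orP[/mapP[z /sP[D [scD Dz]] ->]|/tP//].
by exists D; split=> //; apply: subZ => //; case: scD => -[].
Qed.

Lemma coradical_LR f x : lin_fun f -> coradical hH x ->
  coradical hH (L f x) /\ coradical hH (R f x).
Proof.
move=> lf [s [sP ->]]; rewrite (lin_bigsum (lin_Lop hH lf)) (lin_bigsum (lin_Rop hH lf)).
by split; (apply: sub_sum; first exact: coradical_subspace) => y /sP[D [scD Dy]] _;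
  (exists [:: L f y]; rewrite big_seq1; split=> // _ /[!inE] /eqP->; exists D; split=> //;
   apply: subcoalg_L => //; case: scD) ||
  (exists [:: R f y]; rewrite big_seq1; split=> // _ /[!inE] /eqP->; exists D; split=> //;
   apply: subcoalg_R => //; case: scD).
Qed.

Lemma coradical_subcoalg : subcoalg hH (coradical hH).
Proof.
by apply: subcoalg_of_LR => [|f x lf /(coradical_LR lf)[]|f x lf /(coradical_LR lf)[]] //;
  apply: coradical_subspace.
Qed.

Lemma L_one f : lin_fun f -> L f 1 = f 1 *: 1.
Proof. by move=> lf; rewrite /Lop sw_one //; lin_tac. Qed.

Lemma coradical1 : coradical hH 1.
Proof.
apply: simple_coradical => f lf; rewrite L_one // => fn0.
have f1 : f 1 != 0 by apply/eqP => f1; apply: fn0; rewrite f1 scale0r.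
exists (fun z => (f 1)^-1 * eps z + 0); split.
  by apply: lin_fun_comb; [apply: lin_fun_eps | apply: lin_fun_zero].
by rewrite L_comb L_fun0 addr0 L_eps scalerA mulVf // scale1r.
Qed.

End Coalgebra.

(** * Powers of the coradical and the Hopf subalgebra they generate *)

Section CoradicalPowers.
Variables (k : fieldType) (H : algType k) (hH : hopf H).
Implicit Types (f g : H -> k) (U D E : H -> Prop).

Notation S := (antip hH).
Notation L := (Lop hH).
Notation R := (Rop hH).
Notation cop := (cop hH).
Notation corad := (coradical hH).
Notation K := (H0alg hH).

Lemma corad_pow_subspace m : subspace (corad_pow hH m).
Proof.
split; first by exists [::]; rewrite big_nil.
move=> a _ _ [s [sP ->]] [t [tP ->]].
exists ([seq (a * p.1, p.2) | p <- s] ++ t); split.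
  by move=> p; rewrite mem_cat => /orP[/mapP[q /sP ? ->]|/tP].
rewrite big_cat big_map scaler_sumr /=; congr (_ + _).
by apply: eq_bigr => p _; rewrite scalerA.
Qed.

Lemma H0alg_subspace : subspace K.
Proof.
split; first by exists [::]; rewrite big_nil.
move=> a _ _ [s [sP ->]] [t [tP ->]].
exists ([seq (a * p.1, p.2) | p <- s] ++ t); split.
  by move=> p; rewrite mem_cat => /orP[/mapP[q /sP ? ->]|/tP].
rewrite big_cat big_map scaler_sumr /=; congr (_ + _).
by apply: eq_bigr => p _; rewrite scalerA.
Qed.

Lemma corad_pow_prod (ys : seq H) :
  (forall y, y \in ys -> corad y) -> corad_pow hH (size ys) (\prod_(y <- ys) y).
Proof.
move=> ysP; exists [:: (1, ys)]; rewrite big_seq1 scale1r; split=> //.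
by move=> p /[!inE] /eqP->.
Qed.

Lemma corad_pow_ind m (P : H -> Prop) x : subspace P ->
  (forall ys, size ys = m -> (forall y, y \in ys -> corad y) -> P (\prod_(y <- ys) y)) ->
  corad_pow hH m x -> P x.
Proof.
move=> sP Pprod [s [sm ->]]; apply: sub_sum => // p /sm[pm pc] _.
by apply: subZ => //; apply: Pprod.
Qed.

Lemma corad_pow_H0alg m x : corad_pow hH m x -> K x.
Proof. by move=> [s [sP ->]]; exists s; split=> // p /sP[]. Qed.

Lemma corad_powM m n x y : corad_pow hH m x -> corad_pow hH n y -> corad_pow hH (m + n) (x * y).
Proof.
move=> cx cy; move: cx; apply: (@corad_pow_ind m (fun x => corad_pow hH (m + n) (x * y))).
  split; first by rewrite mul0r; apply: (corad_pow_subspace _).1.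
  move=> a z w cz cw; rewrite mulrDl -scalerAl.
  exact: (corad_pow_subspace _).2.
move=> ys sys ysP; move: cy; apply: (@corad_pow_ind n (fun y => corad_pow hH (m + n) (_ * y))).
  split; first by rewrite mulr0; apply: (corad_pow_subspace _).1.
  move=> a z w cz cw; rewrite mulrDr -scalerAr.
  exact: (corad_pow_subspace _).2.
move=> zs szs zsP; rewrite -big_cat -sys -szs -size_cat; apply: corad_pow_prod.
by move=> z; rewrite mem_cat => /orP[/ysP|/zsP].
Qed.

Lemma corad_pow1 x : corad x -> corad_pow hH 1 x.
Proof.
move=> cx; have := @corad_pow_prod [:: x]; rewrite big_seq1; apply.
by move=> y /[!inE] /eqP->.
Qed.

Lemma corad_pow0 : corad_pow hH 0 1.
Proof. by have := @corad_pow_prod [::]; rewrite big_nil; apply. Qed.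

(** The unit lies in the coradical, so the powers increase; hence a finite sum of products of
    different lengths lies in a single power. *)
Lemma corad_pow_le m n x : (m <= n)%N -> corad_pow hH m x -> corad_pow hH n x.
Proof.
move=> /subnK <-; elim: (n - m)%N => [//|d IH] cx.
rewrite addSn -add1n -[x]mul1r; apply: corad_powM; last exact: IH.
by apply: corad_pow1; apply: coradical1.
Qed.

Lemma H0alg_pow x : K x -> exists m, corad_pow hH m x.
Proof.
move=> [s [sP ->]]; exists (\max_(p <- s) size p.2)%N.
apply: sub_sum => [|p ps _]; first exact: corad_pow_subspace.
apply: subZ; first exact: corad_pow_subspace.
apply: (@corad_pow_le (size p.2)); first exact: (leq_bigmax_seq (F := fun p => size p.2)).
by apply: corad_pow_prod => y; apply: sP.
Qed.

Lemma H0algM x y : K x -> K y -> K (x * y).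
Proof.
by move=> /H0alg_pow[m cx] /H0alg_pow[n cy]; apply: corad_pow_H0alg (corad_powM cx cy).
Qed.

Lemma H0alg1 : K 1.
Proof. exact: corad_pow_H0alg corad_pow0. Qed.

Definition legs D x := exists r, teq r (cop x) /\ forall p, p \in r -> D p.1 /\ D p.2.

Lemma legs_LR D x : subspace D ->
  legs D x <-> forall f, lin_fun f -> D (L f x) /\ D (R f x).
Proof.
move=> sD; split=> [[r [e rD]] f lf|DLR].
  by split; [apply: (rep_L sD lf e) | apply: (rep_R sD lf e)] => p /rD[]; right.
have [f lf|r [e rP]] := @tens_adaptL k H D (cop x) sD; first by have [] := DLR f lf.
exists r; split=> // p /rP[Dp2 [g [lg ->]]]; split=> //.
by have [] := DLR g lg.
Qed.

Lemma legs_subspace D : subspace D -> subspace (legs D).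
Proof.
move=> sD; split.
  apply/(legs_LR _ sD) => f lf.
  by rewrite (lin0 (lin_Lop hH lf)) (lin0 (lin_Rop hH lf)); split; apply: sub0.
move=> a x y /(legs_LR _ sD) Dx /(legs_LR _ sD) Dy; apply/(legs_LR _ sD) => f lf.
have [? ?] := Dx f lf; have [? ?] := Dy f lf.
by rewrite (lin_Lop hH lf) (lin_Rop hH lf); split; apply: sD.2.
Qed.

Lemma teq_cop_mul r1 r2 x y : teq r1 (cop x) -> teq r2 (cop y) ->
  teq [seq (p.1 * q.1, p.2 * q.2) | p <- r1, q <- r2] (cop (x * y)).
Proof.
move=> e1 e2 f g lf lg; rewrite (cop_mul hH x y lf lg) /ev2 !big_allpairs_dep /=.
have lf' : @lin _ H (k^o) f := lf; have lg' : @lin _ H (k^o) g := lg.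
transitivity (\sum_(p <- cop x) \sum_(q <- r2) (f (p.1 * q.1) * g (p.2 * q.2) : k^o)).
  apply: (teq_bteq e1 (B := fun a b => \sum_(q <- r2) (f (a * q.1) * g (b * q.2) : k^o))).
  by split=> [b|a]; apply: lin_sumseq => q; lin_tac.
apply: eq_bigr => p _.
apply: (teq_bteq e2 (B := fun a b => (f (p.1 * a) * g (p.2 * b) : k^o))).
by lin_tac.
Qed.

Lemma legs_mul D E F x y : (forall a b, D a -> E b -> F (a * b)) ->
  legs D x -> legs E y -> legs F (x * y).
Proof.
move=> DEF [r1 [e1 r1D]] [r2 [e2 r2E]]; eexists; split; first exact: teq_cop_mul e1 e2.
move=> _ /allpairsP[[p q] /= [/r1D[? ?] /r2E[? ?] ->]] /=.
by split; apply: DEF.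
Qed.

Lemma corad_pow_legs m x : corad_pow hH m x -> legs (corad_pow hH m) x.
Proof.
apply: corad_pow_ind; first by apply: legs_subspace; apply: corad_pow_subspace.
move=> ys <-; elim: ys => [|y ys IH] ysP.
  rewrite big_nil; exists [:: (1, 1)]; split.
    by apply: teq_sym; apply: cop_one.
  by move=> p /[!inE] /eqP-> /=; split; apply: corad_pow0.
rewrite big_cons; apply: (@legs_mul (corad_pow hH 1) (corad_pow hH (size ys))).
- by move=> a b ca cb; rewrite /= -add1n; apply: corad_powM.
- apply/(legs_LR _ (corad_pow_subspace _)) => f lf.
  have [|] := @coradical_LR _ _ hH f y lf; first by apply: ysP; rewrite mem_head.
  by split; apply: corad_pow1.
- by apply: IH => z zs; apply: ysP; rewrite inE zs orbT.
Qed.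

Lemma H0alg_L f x : lin_fun f -> K x -> K (L f x).
Proof.
move=> lf /H0alg_pow[m /corad_pow_legs/(legs_LR _ (corad_pow_subspace _))/(_ f lf)[+ _]].
exact: corad_pow_H0alg.
Qed.

Lemma H0alg_R f x : lin_fun f -> K x -> K (R f x).
Proof.
move=> lf /H0alg_pow[m /corad_pow_legs/(legs_LR _ (corad_pow_subspace _))/(_ f lf)[_ +]].
exact: corad_pow_H0alg.
Qed.

Hypothesis hS : forall x, corad x -> corad (S x).

Lemma corad_pow_antip m x : corad_pow hH m x -> corad_pow hH m (S x).
Proof.
apply: (@corad_pow_ind m (fun x => corad_pow hH m (S x))).
  split; first by rewrite (lin0 (lin_antip hH)); apply: (corad_pow_subspace m).1.
  by move=> a y z Sy Sz; rewrite (lin_antip hH); apply: (corad_pow_subspace m).2.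
move=> ys <-; elim: ys => [|y ys IH] ysP; first by rewrite big_nil antip1; apply: corad_pow0.
rewrite big_cons antipM /= -addn1; apply: corad_powM.
  by apply: IH => z zs; apply: ysP; rewrite inE zs orbT.
by apply/corad_pow1/hS/ysP; rewrite mem_head.
Qed.

Lemma H0alg_antip x : K x -> K (S x).
Proof. by move=> /H0alg_pow[m cx]; apply: corad_pow_H0alg (corad_pow_antip cx). Qed.

End CoradicalPowers.

(** * The standard filtration as a coalgebra and algebra filtration *)

Section Filtration.
Variables (k : fieldType) (H : algType k) (hH : hopf H).
Implicit Types (f g : H -> k) (U D E : H -> Prop).

Notation L := (Lop hH).
Notation R := (Rop hH).
Notation cop := (cop hH).
Notation K := (H0alg hH).
Notation filt := (filt hH).
Notation lower := (lower hH).

(** Splitting Delta(c) along [D] leaves second legs that are contractions by functionals killing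
    [D]. The wedge thus becomes a condition on contractions. *)
Lemma wedgeP D E c : subspace D -> subspace E ->
  wedge hH D E c <-> forall f, lin_fun f -> kills f D -> E (R f c).
Proof.
move=> sD sE; split=> [[r [e rP]] f lf fD|DE].
  by apply: (rep_R sE lf e) => p /rP[/fD|]; [left | right].
have [//|r1 [r2 [e r1P r2P]]] := @tsplit k H _ _ D (cop c) (subspaceT H) (subspaceT H) sD.
exists (r1 ++ r2); split; first exact: teq_sym.
move=> p; rewrite mem_cat => /orP[/r1P[]|/r2P[_ _ [f [lf fD ->]]]]; first by left.
by right; apply: DE.
Qed.

Lemma filt_subspace n : subspace (filt n).
Proof.
elim: n => [|n IH] /=; first exact: H0alg_subspace.
have sK := H0alg_subspace hH.
split; first by apply/(wedgeP _ IH sK) => f lf _; rewrite (lin0 (lin_Rop hH lf)); apply: sub0.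
move=> a x y /(wedgeP _ IH sK) wx /(wedgeP _ IH sK) wy; apply/(wedgeP _ IH sK) => f lf fn.
by rewrite (lin_Rop hH lf); apply: sK.2; [apply: wx | apply: wy].
Qed.

Lemma lower_subspace n : subspace (lower n).
Proof. by case: n => [|n]; [apply: subspace0 | apply: filt_subspace]. Qed.

Lemma filtSR n x : filt n.+1 x <-> forall f, lin_fun f -> kills f (filt n) -> K (R f x).
Proof. exact: (wedgeP _ (filt_subspace n) (H0alg_subspace hH)). Qed.

Lemma filtSL n x : filt n.+1 x <-> forall g, lin_fun g -> kills g K -> filt n (L g x).
Proof.
split=> [/filtSR Fx g lg gK|Fx].
  apply: (perp_perp (filt_subspace n)) => f lf fn.
  by rewrite LR_adj //; apply: gK; apply: Fx.
apply/filtSR => f lf fn; apply: (perp_perp (H0alg_subspace hH)) => g lg gK.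
by rewrite -LR_adj //; apply: fn; apply: Fx.
Qed.

(** The defining wedge has H_[n] on the left and H_[0] on the right; this is the opposite order,
    that is, associativity of the wedge. The induction rests on [LR_comm]. *)
Lemma filtSR' n x : filt n.+1 x <-> forall g, lin_fun g -> kills g K -> filt n (R g x).
Proof.
elim: n x => [|n IH] x; first exact: filtSR.
split=> [/filtSL Fx g lg gK|Fx].
  by apply/filtSL => h lh hK; rewrite LR_comm //; move: g lg gK; apply/IH; apply: Fx.
apply/filtSL => h lh hK; apply/IH => g lg gK; rewrite -LR_comm //.
by move: h lh hK; apply/filtSL; apply: Fx.
Qed.

Lemma filt_L n f x : lin_fun f -> filt n x -> filt n (L f x).
Proof.
move=> lf; elim: n x => [|n IH] x; first exact: H0alg_L.
move=> /filtSR' Fx; apply/filtSR' => g lg gK; rewrite -LR_comm //.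
by apply: IH; apply: Fx.
Qed.

Lemma filt_R n f x : lin_fun f -> filt n x -> filt n (R f x).
Proof.
move=> lf; elim: n x => [|n IH] x; first exact: H0alg_R.
move=> /filtSL Fx; apply/filtSL => g lg gK; rewrite LR_comm //.
by apply: IH; apply: Fx.
Qed.

Lemma filt_subcoalg n : subcoalg hH (filt n).
Proof.
by apply: subcoalg_of_LR; [apply: filt_subspace | move=> f x; apply: filt_L |
  move=> f x; apply: filt_R].
Qed.

Lemma lower_L n f x : lin_fun f -> lower n x -> lower n (L f x).
Proof.
by case: n => [lf /= ->|n]; [rewrite (lin0 (lin_Lop hH lf)) | apply: filt_L].
Qed.

Lemma lower_R n f x : lin_fun f -> lower n x -> lower n (R f x).
Proof.
by case: n => [lf /= ->|n]; [rewrite (lin0 (lin_Rop hH lf)) | apply: filt_R].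
Qed.

Lemma filtS n x : filt n x -> filt n.+1 x.
Proof. by move=> Fx; apply/filtSL => g lg _; apply: filt_L. Qed.

Lemma filt_le m n x : (m <= n)%N -> filt m x -> filt n x.
Proof. by move=> /subnK <-; elim: (n - m)%N => [//|d IH] Fx; apply/filtS/IH. Qed.

Lemma filt_lower m n x : (m < n)%N -> filt m x -> lower n x.
Proof. by case: n => // n; rewrite ltnS /=; apply: filt_le. Qed.

(** Dual form of the inclusion of Delta(H_[n]) in the sum of the H_[i] (x) H_[n-i]. For positive [i]
    the wedge gives the case n = i, and [filtSL] adds one degree at a time. *)
Lemma filt_perpR n i f x : lin_fun f -> kills f (lower i) -> (i <= n)%N ->
  filt n x -> filt (n - i) (R f x).
Proof.
move=> lf; case: i => [|i] fi lein; first by rewrite subn0; apply: filt_R.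
rewrite -{1}(subnKC lein); move: (n - i.+1)%N => j {lein}.
elim: j x => [|j IH] x Fx; first by move: f lf fi; apply/filtSR; rewrite -[i.+1]addn0.
apply/filtSL => g lg gK; rewrite LR_comm //; apply: IH.
by move: g lg gK; apply/filtSL; rewrite -addnS.
Qed.

Lemma filt_perpL n i f x : lin_fun f -> kills f (lower i) -> (i <= n)%N ->
  filt n x -> filt (n - i) (L f x).
Proof.
move=> lf; case: i => [|i] fi lein; first by rewrite subn0; apply: filt_L.
rewrite -{1}(subnKC lein); move: (n - i.+1)%N => j {lein}.
elim: j x => [|j IH] x Fx.
  apply: (perp_perp (H0alg_subspace hH)) => g lg gK.
  rewrite LR_adj //; apply: fi; move: g lg gK; apply/filtSR'.
  by rewrite -[i.+1]addn0.
apply/filtSR' => g lg gK; rewrite -LR_comm //; apply: IH.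
by move: g lg gK; apply/filtSR'; rewrite -addnS.
Qed.

Definition forget_deg (r : seq (nat * H * H)) := [seq (t.1.2, t.2) | t <- r].

Lemma grep_exists n x : filt n x -> exists r, grep hH n x r.
Proof.
move=> Fx.
(* Degrees are peeled off from the top: after [j] steps the first legs in [r0] have degree at most n
   - j, and [r] holds homogeneous terms of first degree above n - j. At j = n + 1 the first legs in
   [r0] are zero. *)
have main j : (j <= n.+1)%N -> exists r0 r,
  [/\ teq (r0 ++ forget_deg r) (cop x), forall p, p \in r0 -> lower (n.+1 - j) p.1 &
    forall t, t \in r -> [/\ (n.+1 - j <= t.1.1 <= n)%N, filt t.1.1 t.1.2 &
                         filt (n - t.1.1) t.2]].
  elim: j => [|j IH] lejn.
    have [r [e rP]] := (filt_subcoalg n).2 x Fx.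
    by exists r, [::]; rewrite cats0; split=> // p /rP[].
  have [r0 [r [e r0P rP]]] := IH (ltnW lejn).
  set i := (n.+1 - j.+1)%N.
  have iE : (n.+1 - j)%N = i.+1 by rewrite /i; lia.
  have lein : (i <= n)%N by rewrite /i subSS leq_subr.
  rewrite iE in r0P rP.
  have [|r1 [r2 [e' r1P r2P]]] := @tsplit k H (filt i) (fun _ => True) (lower i) r0
    (filt_subspace i) (subspaceT H) (lower_subspace i).
    by move=> p /r0P.
  exists r1, ([seq (i, p.1, p.2) | p <- r2] ++ r); split.
  - apply: teq_trans e => f g lf lg; have := e' f g lf lg.
    rewrite /ev2 /forget_deg map_cat -map_comp !big_cat /= => ->.
    by rewrite big_map /= addrA.
  - by move=> p /r1P[].
  - move=> t; rewrite mem_cat => /orP[/mapP[p /r2P[Fp1 _ [f [lf fi pE]]] ->]|/rP[/andP[lt1 lt2] ? ?]];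
      last by split=> //; rewrite (ltnW lt1) lt2.
    rewrite /= leqnn lein; split=> //; rewrite pE.
    (* The new second legs are contractions of the part not yet peeled off, which is Delta(x) minus
       [r]. *)
    have -> : Rr f r0 = R f x - \sum_(t <- r) f t.1.2 *: t.2.
      rewrite [R f x](teq_Rr lf (teq_sym e)) /Rr big_cat /forget_deg big_map /=.
      by rewrite addrK.
    apply: subB; [exact: filt_subspace | exact: filt_perpR |].
    apply: sub_sum => [|u /rP[/andP[ltu _] _ Fu2] _]; first exact: filt_subspace.
    apply: subZ; first exact: filt_subspace.
    by apply: (filt_le _ Fu2); rewrite leq_sub2l // ltnW.
have [//|r0 [r [e r0P rP]]] := main n.+1.
rewrite subnn in r0P.
exists r; split; last by move=> t /rP[/andP[_ ?] ? ?].
apply: teq_trans e => f g lf lg; rewrite /ev2 big_cat /=.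
suff -> : \sum_(p <- r0) f p.1 * g p.2 = 0 by rewrite add0r.
rewrite big_seq big1 // => p /r0P p0; rewrite (p0 : p.1 = 0).
by have /= -> := lin0 (lf : @lin _ H (k^o) f); rewrite mul0r.
Qed.

(** [f] kills the terms of first degree above... no term below [i] survives [f] and none above [i]
    survives [g], so the comultiplication of gr H, paired with functionals on gr_i and gr_(n-i), is
    read off from Delta itself. *)
Lemma grep_pairing n x r i f g : grep hH n x r -> (i <= n)%N ->
  lin_fun f -> lin_fun g -> kills f (lower i) -> kills g (lower (n - i)) ->
  \sum_(t <- r | t.1.1 == i) f t.1.2 * g t.2 = ev2 f g (cop x).
Proof.
move=> [e rP] lein lf lg fi gi; rewrite -(e f g lf lg) /ev2 big_map /=.
rewrite [RHS](bigID (fun t => t.1.1 == i)) /= [X in _ + X]big_seq_cond [X in _ + X]big1 ?addr0 //.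
move=> t /andP[/rP[len [F1 F2]] ne]; have [lt|gt|eq] := ltngtP t.1.1 i.
- by rewrite fi ?mul0r //; apply: (filt_lower _ F1).
- rewrite gi ?mulr0 //; apply: (filt_lower _ F2).
  by rewrite ltn_sub2l // (leq_trans gt).
- by rewrite eq eqxx in ne.
Qed.

(** In Delta(x) Delta(y) either the first legs have total degree below i + j, where induction
    applies, or both have top degree and both second legs lie in H_[0]. This is membership in the
    wedge. *)
Lemma filtM i j x y : filt i x -> filt j y -> filt (i + j) (x * y).
Proof.
move: {2}(i + j)%N (leqnn (i + j)) => n.
elim: n i j x y => [|n IH] i j x y.
  rewrite leqn0 addn_eq0 => /andP[/eqP-> /eqP->]; exact: H0algM.
move=> leijn Fx Fy; have [/eqP|ij0] := posnP (i + j).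
  by rewrite addn_eq0 => /andP[/eqP i0 /eqP j0]; move: Fx Fy; rewrite i0 j0; exact: H0algM.
have [r [er rP]] := grep_exists Fx; have [s [es sP]] := grep_exists Fy.
case ijE : (i + j)%N ij0 leijn => [//|m] _ lemn.
exists [seq (p.1 * q.1, p.2 * q.2) | p <- forget_deg r, q <- forget_deg s].
split; first exact: teq_cop_mul.
move=> _ /allpairsP[[p q] /= [/mapP[t tr ->] /mapP[u us ->] ->]] /=.
have [let_ [Ft1 Ft2]] := rP _ tr; have [leu [Fu1 Fu2]] := sP _ us.
have [lttu|getu] := ltnP (t.1.1 + u.1.1) (i + j).
  left; apply: (@filt_le (t.1.1 + u.1.1)); first by rewrite -ltnS -ijE.
  by apply: IH => //; rewrite -ltnS (leq_trans lttu) // ijE.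
have [ti uj] : t.1.1 = i /\ u.1.1 = j by lia.
by right; move: Ft2 Fu2; rewrite ti uj !subnn; apply: H0algM.
Qed.

End Filtration.

(** * The filtration exhausts H *)

Section Exhaustive.
Variables (k : fieldType) (H : algType k) (hH : hopf H).
Implicit Types (f g : H -> k) (U D E V M : H -> Prop).

Notation eps := (cou hH).
Notation L := (Lop hH).
Notation R := (Rop hH).
Notation cop := (cop hH).
Notation corad := (coradical hH).
Notation filt := (filt hH).

Lemma R_coideal_kill V f v : right_coideal hH V -> lin_fun f -> kills f V -> V v -> R f v = 0.
Proof.
move=> [_ VL] lf fV Vv; apply: functional_eq0 => g lg.
by rewrite -LR_adj //; apply/fV/VL.
Qed.

(** [f] vanishes on the intersection of V and M, so [R f] factors through the quotient of V by it.
    There [x] generates a simple subcomodule, which a comodule map to H carries into the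
    coradical. *)
Lemma simple_quotient_coradical V M x f : right_coideal hH V -> right_coideal hH M -> V x ->
  (forall c, ~ M c -> exists g, lin_fun g /\ M (x - L g c)) ->
  lin_fun f -> (forall v, V v -> M v -> f v = 0) -> corad (R f x).
Proof.
move=> rV rM Vx Mmax lf fVM.
have rVM : right_coideal hH (fun v => V v /\ M v).
  split=> [|g v lg [Vv Mv]]; first exact: subspaceI rV.1 rM.1.
  by split; [apply: rV.2 | apply: rM.2].
have kill v : V v -> M v -> R f v = 0.
  by move=> Vv Mv; apply: (R_coideal_kill rVM) => // w []; apply: fVM.
apply: simple_coradical => h lh; rewrite LR_comm // => hn0.
have Vhx : V (L h x) by apply: rV.2.
have [g [lg Mg]] : exists g, lin_fun g /\ M (x - L g (L h x)).
  by apply: Mmax => Mhx; apply: hn0; apply: kill.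
exists g; split=> //.
have := kill (x - L g (L h x)); rewrite (linB (lin_Rop hH lf)) -LR_comm // => /(_ _ Mg) e.
apply/esym/eqP; rewrite -subr_eq0 e //.
by apply: subB => //; [exact: rV.1 | apply: rV.2].
Qed.

Lemma coideal_gen x : right_coideal hH (fun y => exists f, lin_fun f /\ y = L f x).
Proof.
split; last first.
  move=> f _ lf [g [lg ->]]; exists (fun z => f (L g z)); rewrite L_comp //.
  by split=> //; apply: lin_fun_L.
split; first by exists (fun _ => 0); rewrite L_fun0; split=> //; apply: lin_fun_zero.
move=> a _ _ [f [lf ->]] [g [lg ->]].
exists (fun z => a * f z + g z); rewrite L_comb; split=> //.
exact: lin_fun_comb.
Qed.

(** Induction on dimension. For [x] in V take [M] maximal avoiding [x]: the intersection of V and M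
    is smaller, hence inside some H_[n]; if [f] kills H_[n], then [R f x] lies in the coradical, so
    [x] lies in H_[n+1]. *)
Lemma coideal_filt V (s : seq H) : right_coideal hH V ->
  (forall v, V v -> inspan (fun x => x = 0) s v) -> exists n, forall v, V v -> filt n v.
Proof.
move: {2}(size s) (erefl (size s)) => N; elim: N s V => [|N IH] s V sN rV Vs.
  exists 0 => v /Vs; rewrite (size0nil sN) => v0; rewrite (v0 : v = 0).
  exact: sub0 (filt_subspace hH 0).
have each x : V x -> exists n, filt n x.
  move=> Vx; have [->|xn0] := pselect (x = 0); first by exists 0; apply: sub0 (filt_subspace hH 0).
  have r0 : right_coideal hH (fun y => y = 0).
    by split=> [|f _ lf ->]; [apply: subspace0 | apply: lin0 (lin_Lop hH lf)].
  have [M [rM _ nMx Mmax]] := max_right_coideal r0 xn0.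
  pose V' v := V v /\ M v.
  have rV' : right_coideal hH V'.
    split=> [|g v lg [Vv Mv]]; first exact: subspaceI rV.1 rM.1.
    by split; [apply: rV.2 | apply: rM.2].
  (* A functional zero on [V'] and nonzero at [x] witnesses the drop in dimension. *)
  have [h [lh hV' hx]] : exists h, [/\ lin_fun h, kills h V' & h x = 1].
    by apply: separation; [apply: rV'.1 | case].
  have [|s' [ss' s'P]] := inspan_drop lh (Vs _ Vx).
    by rewrite hx; apply/eqP/oner_neq0.
  have [|v [Vv Mv]|n V'n] := IH s' V' _ rV'.
  - by move: ss'; rewrite sN => -[].
  - by apply: s'P; [apply: Vs | apply: hV'].
  exists n.+1; apply/filtSR => f lf fn.
  have : corad (R f x).
    by apply: (simple_quotient_coradical rV rM) => // v Vv Mv; apply/fn/V'n.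
  by move/corad_pow1/corad_pow_H0alg.
(* A finite spanning list inside V makes the degree uniform. *)
have [t [tV Vt]] := inspan_refine (@subspace0 _ H) rV.1 Vs.
have [n nP] : exists n, forall x, x \in t -> filt n x.
  elim: t tV {Vt} => [|x t IHt] tV; first by exists 0.
  have [|n nP] := IHt; first by move=> y yt; apply: tV; rewrite inE yt orbT.
  have [m mP] := each x (tV _ (mem_head _ _)).
  exists (maxn n m) => y; rewrite inE => /orP[/eqP->|yt].
    by apply: filt_le mP; apply: leq_maxr.
  by apply: filt_le (nP _ yt); apply: leq_maxl.
exists n => v /Vt; apply: inspan_min => //; first exact: filt_subspace.
by move=> x ->; apply: sub0 (filt_subspace hH n).
Qed.

(** The right coideal generated by [x] lies in the span of the first legs of Delta(x), so it is
    finite dimensional. *)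
Lemma filt_exhaustive x : exists n, filt n x.
Proof.
have [||n nP] := @coideal_filt (fun y => exists f, lin_fun f /\ y = L f x) [seq p.1 | p <- cop x].
- exact: coideal_gen.
- move=> _ [f [lf ->]]; apply: sub_sum => [|p px _]; first exact: (inspan_sub _ (@subspace0 _ H)).
  apply: subZ; first exact: (inspan_sub _ (@subspace0 _ H)).
  by apply: inspan_mem; [apply: subspace0 | apply/mapP; exists p].
exists n; apply: nP; exists eps; split; last by rewrite L_eps.
exact: lin_fun_eps.
Qed.

End Exhaustive.

(** * The antipode on the filtration *)

Section Antipode.
Variables (k : fieldType) (H : algType k) (hH : hopf H).
Implicit Types (f g : H -> k) (U D E V M : H -> Prop).

Notation S := (antip hH).
Notation eps := (cou hH).
Notation sw := (sw hH).
Notation L := (Lop hH).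
Notation R := (Rop hH).
Notation cop := (cop hH).
Notation corad := (coradical hH).
Notation K := (H0alg hH).
Notation filt := (filt hH).
Notation lower := (lower hH).

Lemma teq_cop_antip r x : teq r (cop x) ->
  teq [seq (S p.2, S p.1) | p <- r] (cop (S x)).
Proof.
move=> e f g lf lg; have lf' : @lin _ H (k^o) f := lf; have lg' : @lin _ H (k^o) g := lg.
rewrite ev2_sw sw_antip; last exact: bilin_ev.
rewrite (sw_teq _ e) /ev2 ?big_map //; lin_tac.
Qed.

Lemma L_antip f x : lin_fun f -> L f (S x) = S (R (fun z => f (S z)) x).
Proof.
move=> lf; have lf' : @lin _ H (k^o) f := lf.
rewrite {1}/Lop sw_antip; last by lin_tac.
rewrite {1}/Rop (sw_lin hH (fun a b => f (S a) *: b) x (lin_antip hH)).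
by apply: eq_sw => a b; rewrite (linZ (lin_antip hH)).
Qed.

(** In S(x_1) (x_2 y)_1 the factor S(x_1) x_2 cancels. If [g] is an integral, the left side becomes
    f(S(x_1)) g(x_2 y). *)
Lemma starstar f g x y : lin_fun f -> lin_fun g ->
  sw (fun a b => ev2 (fun z => f (S a * z)) g (cop (b * y)) : k^o) x =
  ev2 f (fun z => g (x * z)) (cop y).
Proof.
move=> lf lg; have lf' : @lin _ H (k^o) f := lf; have lg' : @lin _ H (k^o) g := lg.
pose T a c d := sw (fun u v => (f (S a * (c * u)) * g (d * v) : k^o)) y.
transitivity (sw (fun a b => sw (T a) b) x).
  apply: eq_sw => a b; rewrite ev2_sw sw_mul //; lin_tac.
rewrite -sw_coassoc; last by rewrite /T; lin_tac.
transitivity (sw (fun u v => (f (1 * u) * g (x * v) : k^o)) y); last first.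
  by rewrite ev2_sw; apply: eq_sw => u v; rewrite mul1r.
apply: (sw_counitl (G := fun d => sw (fun u v => (f (1 * u) * g (d * v) : k^o)) y)); first by lin_tac.
move=> z d; apply: (sw_antipl (G := fun w => sw (fun u v => (f (w * u) * g (d * v) : k^o)) y)).
  by lin_tac.
by move=> a c; rewrite /T; apply: eq_sw => u v; rewrite mulrA.
Qed.

Hypothesis hS : forall x, corad x -> corad (S x).

(** S reverses Delta, so the legs of a graded representation trade places: for [x] in H_[n+1], a
    term of first degree i > 0 acquires a first leg in H_[n+1-i], hence in H_[n], and a term with i
    = 0 a second leg in H_[0]. *)
Lemma filt_antip n x : filt n x -> filt n (S x).
Proof.
move: {2}n (leqnn n) => m; elim: m n x => [|m IH] n x lenm Fx.
  by move: lenm Fx; rewrite leqn0 => /eqP->; apply: H0alg_antip.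
case: n lenm Fx => [|n] lenm Fx; first exact: H0alg_antip.
have [r [e rP]] := grep_exists Fx.
exists [seq (S p.2, S p.1) | p <- forget_deg r]; split; first exact: teq_cop_antip.
move=> _ /mapP[_ /mapP[t /rP[le_t [F1 F2]] ->] ->] /=.
have [t0|tpos] := posnP t.1.1; [right | left].
  by move: F1; rewrite t0; apply: H0alg_antip.
by apply: (@filt_le _ _ _ (n.+1 - t.1.1)); [lia | apply: IH => //; lia].
Qed.

Lemma lower_antip n x : lower n x -> lower n (S x).
Proof.
by case: n => [x0|n]; [rewrite (x0 : x = 0); apply: lin0 (lin_antip hH) | apply: filt_antip].
Qed.

Lemma lowerMr n x y : lower n x -> K y -> lower n (x * y).
Proof.
case: n => [|n] Fx Ky; first by rewrite (Fx : x = 0) mul0r.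
by rewrite -[n]addn0; apply: filtM.
Qed.

Lemma lowerMl n x y : K x -> lower n y -> lower n (x * y).
Proof.
case: n => [|n] Kx Fy; first by rewrite (Fy : y = 0) mulr0.
exact: (@filtM _ _ _ 0).
Qed.

Lemma coact_antipl (P : H -> Prop) g z x : (forall x y, P x -> K y -> P (x * y)) ->
  K z -> lin_fun g -> P x ->
  (forall x f, P x -> lin_fun f -> ev2 f (fun w => g (x * w)) (cop z) = 0) ->
  eps z * g x = 0.
Proof.
move=> PK Kz lg Px z0; have lg' : @lin _ H (k^o) g := lg.
have := @sw_antipl _ _ hH (k^o) (fun w => g (x * w)) _ z _ (fun _ _ => erefl).
rewrite mulr1 /GRing.scale /= => <-; last by lin_tac.
have [f lf|r [e rP]] := @tens_adaptR k H K (cop z) (H0alg_subspace hH); first exact: H0alg_L.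
rewrite (sw_teq _ e); last by lin_tac.
rewrite big_seq big1 // => p /rP[Kp [f [lf ->]]].
have lgx : lin_fun (fun w => g (x * S p.1 * w)).
  by rewrite /lin_fun -/(@lin _ H (k^o) _); lin_tac.
by rewrite mulrA [LHS](f_Rop hH f z lgx) z0 //; apply: PK => //; apply: H0alg_antip.
Qed.

Lemma coact_antipr (P : H -> Prop) g z x : (forall x y, P x -> K y -> P (y * x)) ->
  K z -> lin_fun g -> P x ->
  (forall x f, P x -> lin_fun f -> ev2 (fun w => g (w * x)) f (cop z) = 0) ->
  eps z * g x = 0.
Proof.
move=> PK Kz lg Px z0; have lg' : @lin _ H (k^o) g := lg.
have := @sw_antipr _ _ hH (k^o) (fun w => g (w * x)) _ z _ (fun _ _ => erefl).
rewrite mul1r /GRing.scale /= => <-; last by lin_tac.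
have [f lf|r [e rP]] := @tens_adaptL k H K (cop z) (H0alg_subspace hH); first exact: H0alg_R.
rewrite (sw_teq _ e); last by lin_tac.
rewrite big_seq big1 // => p /rP[Kp [f [lf ->]]].
have lgx : lin_fun (fun w => g (w * (S p.2 * x))).
  by rewrite /lin_fun -/(@lin _ H (k^o) _); lin_tac.
by rewrite -mulrA [LHS](f_Lop hH f z lgx) z0 //; apply: PK => //; apply: H0alg_antip.
Qed.

End Antipode.

(** * Coinvariants of the Hopf modules H_[n] / H_[n-1] *)

Section Coinvariants.
Variables (k : fieldType) (H : algType k) (hH : hopf H).
Implicit Types (f g : H -> k) (U D E V M : H -> Prop).

Notation S := (antip hH).
Notation eps := (cou hH).
Notation sw := (sw hH).
Notation cop := (cop hH).
Notation corad := (coradical hH).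
Notation K := (H0alg hH).
Notation filt := (filt hH).
Notation lower := (lower hH).

Hypothesis hS : forall x, corad x -> corad (S x).

(* The class of [y] in [H_[n] / H_[n-1]] is right coinvariant under [H_[0]],
   i.e. it lies in the degree [n] part of the diagram. *)
Definition coinvariant n y := forall f g, lin_fun f -> lin_fun g ->
  kills f (lower n) -> ev2 f g (cop y) = f y * g 1.

(** Splitting Delta(y) along [lower n] leaves second legs that are contractions by functionals
    killing H_[n-1], and these lie in H_[0]. *)
Lemma sw_eq_filt (W : lmodType k) n (B B' : H -> H -> W) y : bilin B -> bilin B' -> filt n y ->
  (forall a b, lower n a -> B a b = B' a b) ->
  (forall a b, K b -> B a b = B' a b) -> sw B y = sw B' y.
Proof.
move=> bB bB' Fy e1 e2.
have [//|r1 [r2 [e r1P r2P]]] :=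
  @tsplit k H _ _ (lower n) (cop y) (subspaceT H) (subspaceT H) (lower_subspace hH n).
rewrite (sw_teq bB (teq_sym e)) (sw_teq bB' (teq_sym e)); apply: eq_big_seq => p.
rewrite mem_cat => /orP[/r1P[_ lp _]|/r2P[_ _ [f [lf fn pE]]]]; first exact: e1.
by apply: e2; rewrite pE; have := filt_perpR lf fn (leqnn n) Fy; rewrite subnn.
Qed.

Lemma sw_eq_H0alg (W : lmodType k) (B B' : H -> H -> W) y : bilin B -> bilin B' -> K y ->
  (forall a b, K a -> K b -> B a b = B' a b) -> sw B y = sw B' y.
Proof.
move=> bB bB' Ky eB; have [r [e rP]] := (filt_subcoalg hH 0).2 y Ky.
rewrite (sw_teq bB e) (sw_teq bB' e); apply: eq_big_seq => p /rP[].
exact: eB.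
Qed.

Lemma lin_fun_mulr g x : lin_fun g -> lin_fun (fun w => g (w * x)).
Proof.
move=> lg; have lg' : @lin _ H (k^o) g := lg.
by have : @lin _ H (k^o) (fun w => g (w * x)) by lin_tac.
Qed.

Lemma lin_fun_mull g x : lin_fun g -> lin_fun (fun w => g (x * w)).
Proof.
move=> lg; have lg' : @lin _ H (k^o) g := lg.
by have : @lin _ H (k^o) (fun w => g (x * w)) by lin_tac.
Qed.

Lemma lin_fun_antip g : lin_fun g -> lin_fun (fun w => g (S w)).
Proof.
move=> lg; have lg' : @lin _ H (k^o) g := lg.
by have : @lin _ H (k^o) (fun w => g (S w)) by lin_tac.
Qed.

Variable rho : H -> H.
Hypotheses (lrho : lin rho) (Krho : forall x, K (rho x)) (rhoK : forall x, K x -> rho x = x).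

(** The projection y_(0) S(y_(1)) of a Hopf module onto its coinvariants. The coaction takes values
    in H_[0] only modulo H_[n-1]; [rho] forces the second leg into H_[0] on all of H. *)
Definition coinv_proj y := sw (fun a b => a * S (rho b)) y.

Lemma coinv_proj_filt n y : filt n y -> filt n (coinv_proj y).
Proof.
move=> Fy; have [r [e rP]] := (filt_subcoalg hH n).2 y Fy.
rewrite /coinv_proj (sw_teq _ e); last by lin_tac.
apply: sub_sum => [|p /rP[Fp _] _]; first exact: filt_subspace.
by rewrite -[n]addn0; apply: filtM => //; apply: H0alg_antip.
Qed.

(** On second legs in H_[0] this is the usual computation Delta(y_1 S(y_2)) = y_1 S(y_4) (x) y_2
    S(y_3), where y_2 S(y_3) cancels; terms with first leg in [lower n] vanish under [f]. *)
Lemma coinv_proj_coinvariant n y : filt n y -> coinvariant n (coinv_proj y).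
Proof.
move=> Fy f g lf lg fn; have lf' : @lin _ H (k^o) f := lf; have lg' : @lin _ H (k^o) g := lg.
pose B u v := (f u * g v : k^o).
have bB : bilin B by rewrite /B; lin_tac.
pose T a c b := sw (fun u v => B (a * u) (c * v)) (S (rho b)).
have lT : trilin T by rewrite /T; lin_tac.
rewrite ev2_sw -/B /coinv_proj (sw_lin hH _ y (lin_sw hH bB)).
transitivity (sw (fun a b => sw (T a) b) y).
  rewrite -(sw_coassoc hH y lT); apply: (@eq_sw _ _ hH (k^o)) => a b.
  by rewrite sw_mul.
have -> : f (sw (fun a b => a * S (rho b)) y) * g 1 =
    sw (fun a b => (f (a * S (rho b)) * g 1 : k^o)) y.
  by rewrite (sw_lin hH _ y (lin_kmulr (g 1) lf')).
apply: (@sw_eq_filt (k^o) n) => //.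
- by case: lT => T1 T2 T3; split=> a; [apply: lin_sw_body | apply: lin_sw; split=> ?].
- by lin_tac.
- move=> a b la; rewrite fn ?mul0r; last by apply: lowerMr => //; apply: H0alg_antip.
  rewrite /sw big1 // => p _.
  transitivity (ev2 (fun w => f (a * w)) (fun w => g (p.1 * w)) (cop (S (rho p.2)))) => //.
  rewrite -(f_Lop hH) //; last exact: lin_fun_mull.
  apply: fn; apply: lowerMr => //; apply: H0alg_L; first exact: lin_fun_mull.
  exact: H0alg_antip.
- move=> a b Kb; rewrite (rhoK Kb).
  pose T' c d := sw (fun u v => B (a * u) (c * v)) (S d).
  have bT' : bilin T' by rewrite /T'; lin_tac.
  transitivity (sw T' b).
    apply: (@sw_eq_H0alg (k^o)) => //; first by rewrite /T; lin_tac.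
    by move=> c d Kc Kd; rewrite /T rhoK.
  transitivity (sw (fun c d => sw (fun u v => B (a * S v) (c * S u)) d) b).
    by apply: (@eq_sw _ _ hH (k^o)) => c d; rewrite /T' sw_antip //; lin_tac.
  rewrite -(@sw_coassoc _ _ hH (k^o) (fun c u v => B (a * S v) (c * S u)) _); last by lin_tac.
  apply: (sw_counitl (G := fun v => (f (a * S v) * g 1 : k^o))) => [|z v]; first by lin_tac.
  by apply: (sw_antipr (G := fun w => B (a * S v) w)) => //; apply: bB.2.
Qed.

(** Modulo H_[n-1] one has y = y_1 S(y_2) y_3, and [rho] is the identity on legs in H_[0]. *)
Lemma coinv_proj_gen n y f : filt n y -> lin_fun f -> kills f (lower n) ->
  f y = sw (fun a b => (f (coinv_proj a * rho b) : k^o)) y.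
Proof.
move=> Fy lf fn; have lf' : @lin _ H (k^o) f := lf.
transitivity (sw (fun a b => sw (fun c d => (f (a * (S (rho c) * rho d)) : k^o)) b) y); last first.
  rewrite -(@sw_coassoc _ _ hH (k^o) (fun a c d => (f (a * (S (rho c) * rho d)) : k^o)) _); last by lin_tac.
  apply: (@eq_sw _ _ hH (k^o)) => a b; rewrite /coinv_proj.
  have lfb : @lin _ H (k^o) (fun w => f (w * rho b)) by lin_tac.
  by rewrite [RHS](sw_lin hH _ a lfb); apply: (@eq_sw _ _ hH (k^o)) => c d; rewrite mulrA.
transitivity (sw (fun a b => (eps b * f a : k^o)) y).
  by symmetry; apply: (sw_counitr (G := f : H -> k^o)).
apply: (@sw_eq_filt (k^o) n) => //.
- have le := lin_eps hH; lin_tac.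
- by lin_tac.
- move=> a b la; rewrite fn // mulr0 /sw big1 // => p _; apply: fn.
  by apply: lowerMr => //; apply: H0algM => //; apply: H0alg_antip.
- move=> a b Kb; transitivity (sw (fun c d => (f (a * (S c * d)) : k^o)) b).
    rewrite (sw_antipl (G := fun w => (f (a * w) : k^o))) ?mulr1 //; lin_tac.
  by apply: (@sw_eq_H0alg (k^o)) => //; [lin_tac | lin_tac | move=> c d Kc Kd; rewrite !rhoK].
Qed.

End Coinvariants.

(** * Homogeneous integrals of gr H *)

Section Integrals.
Variables (k : fieldType) (H : algType k) (hH : hopf H).
Implicit Types (f g mu : H -> k) (U D E V M : H -> Prop).

Notation S := (antip hH).
Notation eps := (cou hH).
Notation sw := (sw hH).
Notation L := (Lop hH).
Notation R := (Rop hH).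
Notation cop := (cop hH).
Notation corad := (coradical hH).
Notation K := (H0alg hH).
Notation filt := (filt hH).
Notation lower := (lower hH).
Notation coinvariant := (coinvariant hH).

Hypothesis hS : forall x, corad x -> corad (S x).

(* Fundamental theorem of Hopf modules for [H_[n] / H_[n-1]] over [H_[0]]: it is
   spanned by products of coinvariants with [H_[0]]. *)
Lemma coinvariant_span n f y : lin_fun f -> kills f (lower n) ->
  (forall p c, filt n p -> coinvariant n p -> K c -> f (p * c) = 0) ->
  filt n y -> f y = 0.
Proof.
move=> lf fn fpc Fy; have lf' : @lin _ H (k^o) f := lf.
have [|rho [lrho Krho rhoK _]] := proj_along (@subspace0 _ H) (H0alg_subspace hH).
  by [].
rewrite (coinv_proj_gen hS lrho Krho rhoK Fy lf fn).
have [r [e rP]] := (filt_subcoalg hH n).2 y Fy.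
rewrite (sw_teq _ e); last by rewrite /coinv_proj; lin_tac.
rewrite big_seq big1 // => p /rP[Fp _]; apply: fpc => //.
  exact: coinv_proj_filt.
exact: coinv_proj_coinvariant.
Qed.

Lemma coinvariant_all n y : (forall p, filt n p -> coinvariant n p -> lower n p) ->
  filt n y -> lower n y.
Proof.
move=> all_low Fy; apply: (perp_perp (lower_subspace hH n)) => f lf fn.
apply: (coinvariant_span lf fn _ Fy) => p c Fp cp Kc; apply: fn.
by apply: lowerMr => //; apply: all_low.
Qed.

(* A nonzero left integral on [gr H] concentrated in degree [d]. *)
Definition gr_integral d mu := [/\ lin_fun mu, kills mu (lower d),
  exists x, filt d x /\ mu x <> 0 &
  forall i h f, filt (i + d) h -> lin_fun f -> kills f (lower i) ->
    ev2 f mu (cop h) = if i == 0 then mu h * f 1 else 0].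

Section GrIntegral.
Variables (d : nat) (mu : H -> k).
Hypothesis int_mu : gr_integral d mu.

Let lmu : lin_fun mu. Proof. by case: int_mu. Qed.

(** By [starstar] a term (i, a, b) of [r] contributes the pairing of f(S(a) -) and [mu] with Delta(b
    y), where b y has degree d - i + n. For i < n this exceeds d and the integral property gives 0;
    for i > n it is below d and [mu] vanishes; i = n remains. *)
Lemma gr_integral_antip n x r y f : filt d x -> grep hH d x r -> filt n y ->
  lin_fun f -> kills f (lower n) ->
  ev2 f (fun z => mu (x * z)) (cop y) = \sum_(t <- r | t.1.1 == n) mu (t.2 * y) * f (S t.1.2).
Proof.
have [_ mud _ mu_int] := int_mu.
have lmu' : @lin _ H (k^o) mu := lmu.
move=> Fx [e rP] Fy lf fn; have lf' : @lin _ H (k^o) f := lf.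
rewrite -starstar // (sw_teq _ e); last first.
  split=> [b|a].
    have : @lin _ H (k^o) (fun a => sw (fun u v => (f (S a * u) * mu v : k^o)) (b * y)) by lin_tac.
    by [].
  have : @lin _ H (k^o) (fun b => sw (fun u v => (f (S a * u) * mu v : k^o)) (b * y)) by lin_tac.
  by [].
rewrite big_map big_seq_cond [RHS]big_seq_cond big_mkcond [RHS]big_mkcond /=.
apply: eq_bigr => -[[i a] b] _; case tr: (_ \in r) => //=.
have [le_t [F1 F2]] := rP _ tr; rewrite /= in le_t F1 F2.
have lft : lin_fun (fun z => f (S a * z)) by apply: lin_fun_mull.
have Fty : filt (d - i + n) (b * y) by apply: filtM.
have [lt|gt|eq] := ltngtP i n.
- rewrite (mu_int (n - i)%N) //.
  + by rewrite subn_eq0 leqNgt lt.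
  + by rewrite addnBAC ?(ltnW lt) // addnC -addnBAC.
  + move=> z lz; apply: fn; case: n lt lz {Fy Fty} => // n lt lz.
    apply: (@filt_le _ _ _ (i + (n - i))); first by lia.
    apply: filtM; first exact: filt_antip.
    by rewrite subSn in lz.
- rewrite ev2_sw; have [r' [e' r'P]] : exists r', teq r' (cop (b * y)) /\
      forall p, p \in r' -> lower d p.1 /\ lower d p.2.
    have Fd : filt d.-1 (b * y) by apply: (filt_le _ Fty); lia.
    have [r' [e' r'P]] := (filt_subcoalg hH d.-1).2 _ Fd.
    by exists r'; split=> // p /r'P[]; case: (d) le_t gt => [|d'] //; lia.
  rewrite (sw_teq _ e'); last by lin_tac.
  by rewrite big_seq big1 // => p /r'P[_ /mud ->]; rewrite mulr0.
- rewrite (mu_int 0%N) ?mulr1 //.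
  + by move: Fty; rewrite eq add0n subnK // -eq.
  + by move=> z z0; rewrite (z0 : z = 0) mulr0; apply: (lin0 lf').
Qed.

(** [R f y] lies in H_[0] and has counit f(y), so [coact_antipl] with an [x] at which [mu] is
    nonzero concludes. Surjectivity of S and vanishing above degree [d] both reduce to this. *)
Lemma gr_integral_faithful n y f : lin_fun f -> kills f (lower n) -> filt n y ->
  (forall x z g, filt d x -> filt n z -> lin_fun g ->
     ev2 (fun w => f (L g w)) (fun w => mu (x * w)) (cop z) = 0) -> f y = 0.
Proof.
move=> lf fn Fy f0; have [_ _ [x [Fx mux]] _] := int_mu.
have Kz : K (R f y) by have := filt_perpR lf fn (leqnn n) Fy; rewrite subnn.
have : eps (R f y) * mu x = 0.
  apply: (@coact_antipl _ _ _ hS (filt d) mu _ x) => //.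
    by move=> u v Fu Kv; rewrite -[d]addn0; apply: filtM.
  move=> u g Fu lg; have lmuu := lin_fun_mull u lmu.
  rewrite -(f_Rop hH) // R_comp //.
  have -> : R (fun z => g (R f z)) y = R (fun z => f (L g z)) y.
    by rewrite /Rop; apply: eq_sw => a b; rewrite -LR_adj.
  have /= -> := f_Rop hH (fun z => f (L g z)) y lmuu; exact: f0.
move/eqP; rewrite mulf_eq0 eps_R // => /orP[/eqP//|/eqP].
by move/mux.
Qed.

(* [S] is surjective modulo [H_[n-1]] on [H_[n]]. *)
Lemma gr_integral_antip_surj n y f : lin_fun f -> kills f (lower n) -> filt n y ->
  (forall x, filt n x -> f (S x) = 0) -> f y = 0.
Proof.
move=> lf fn Fy fS; apply: (gr_integral_faithful lf fn Fy) => x z g Fx Fz lg.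
have [r gr] := grep_exists Fx.
rewrite (gr_integral_antip Fx gr Fz); last 2 first.
- exact: lin_fun_L.
- by move=> w lw; apply/fn/lower_L.
rewrite big_seq_cond big1 // => t /andP[tr /eqP tn].
rewrite L_antip // fS ?mulr0 //; apply: filt_R; first exact: lin_fun_antip.
by rewrite -tn; have [_ /(_ _ tr)[_ []]] := gr.
Qed.

Lemma gr_integral_top n y : (d < n)%N -> filt n y -> lower n y.
Proof.
move=> ltdn Fy; apply: (perp_perp (lower_subspace hH n)) => f lf fn.
apply: (gr_integral_faithful lf fn Fy) => x z g Fx Fz lg.
have [r gr] := grep_exists Fx.
rewrite (gr_integral_antip Fx gr Fz); last 2 first.
- exact: lin_fun_L.
- by move=> w lw; apply/fn/lower_L.
rewrite big_seq_cond big1 // => t /andP[tr /eqP tn].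
by have [_ /(_ _ tr)[le_t _]] := gr; move: ltdn; rewrite -tn ltnNge le_t.
Qed.

Lemma gr_integral_filt_all x : filt d x.
Proof.
have [n Fx] := filt_exhaustive hH x.
have [led|] := leqP n d; first exact: (filt_le led).
elim: n Fx => // n IH Fx; rewrite ltnS => ledn.
have := gr_integral_top (n := n.+1) ledn Fx => /= Fn.
by move: ledn; rewrite leq_eqVlt => /orP[/eqP->//|]; apply: IH.
Qed.

(** Induction along the filtration: if the image of S contains [lower m], a functional killing that
    image kills [lower m], hence H_[m] as well. *)
Lemma gr_integral_antip_onto y : exists x, y = S x.
Proof.
suff main n z : filt n z -> exists x, z = S x by have [n Fn] := filt_exhaustive hH y; apply: main Fn.
have sim : subspace (fun z => exists x, z = S x).
  split; first by exists 0; rewrite (lin0 (lin_antip hH)).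
  by move=> a _ _ [u ->] [v ->]; exists (a *: u + v); rewrite (lin_antip hH).
have step m : (forall z, lower m z -> exists x, z = S x) ->
    forall z, filt m z -> exists x, z = S x.
  move=> low w Fw; apply: (perp_perp sim) => f lf fS.
  apply: (gr_integral_antip_surj lf _ Fw) => [u /low|u _]; first by apply: fS.
  by apply: fS; exists u.
elim: n z => [|n IH]; apply: step => // z z0.
by exists 0; rewrite (z0 : z = 0) (lin0 (lin_antip hH)).
Qed.

(** The integral is w |-> mu(w S(p)) with [p] coinvariant of degree [d]. Under [mu], coinvariance
    makes Delta(S(p)) act as 1 (x) S(p), so the integral property of [mu] at h S(p) becomes that of
    the new functional at h. *)
Lemma gr_integral_coFrob_H0alg : coFrob_sub hH K.
Proof.
have [_ mud [x [Fx mux]] mu_int] := int_mu.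
(* Otherwise [mu] vanishes on S(H_[d]), as H_[d] is spanned modulo H_[d-1] by such products, and
   then on H_[d] because S is onto modulo H_[d-1]. *)
have [p [c [Fp cp Kc mpc]]] : exists p c, [/\ filt d p, coinvariant d p, K c & mu (S (p * c)) <> 0].
  apply: contrapT => no; apply: mux.
  apply: (gr_integral_antip_surj lmu mud Fx) => y Fy.
  apply: (coinvariant_span (n := d) (lin_fun_antip hH lmu) _ _ Fy).
    by move=> z lz; apply/mud/lower_antip.
  move=> p c Fp cp Kc; apply: contrapT => mpc; apply: no; exists p, c; split=> //.
have lmup : lin_fun (fun w => mu (w * S p)) by apply: lin_fun_mulr.
exists (fun w => mu (w * S p)); split=> //; split.
  exists (S c); split; first exact: H0alg_antip.
  by rewrite -antipM.
move=> h Kh; apply: functional_eq => f lf.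
have lf' : @lin _ H (k^o) f := lf; have lmu' : @lin _ H (k^o) mu := lmu.
have /= -> := linZ lf' (mu (h * S p)) 1.
rewrite -/(sw (fun a b => mu (b * S p) *: a) h) -/(L (fun b => mu (b * S p)) h) f_Lop //.
have hp : ev2 f mu (cop (h * S p)) = mu (h * S p) * f 1.
  rewrite (mu_int 0%N) //; last by move=> z z0; rewrite (z0 : z = 0); apply: (lin0 lf').
  by apply: filtM => //; apply: filt_antip.
rewrite -[RHS]hp !ev2_sw sw_mul; last by lin_tac.
have [r [e rP]] := (filt_subcoalg hH 0).2 h Kh.
rewrite !(sw_teq _ e); [|by lin_tac|by lin_tac].
apply: eq_big_seq => q /rP[Kq1 Kq2].
rewrite sw_antip; last by lin_tac.
have := cp (fun w => mu (q.2 * S w)) (fun w => f (q.1 * S w)).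
rewrite ev2_sw antip1 mulr1 => cpE.
transitivity (mu (q.2 * S p) * f q.1); first exact: mulrC.
rewrite -cpE.
- by apply: (@eq_sw _ _ hH (k^o)) => a b; rewrite mulrC.
- by apply: (lin_fun_antip hH (lin_fun_mull _ lmu)).
- by apply: (lin_fun_antip hH (lin_fun_mull _ lf)).
- by move=> z lz; apply/mud/lowerMl => //; apply: lower_antip.
Qed.

(** The spanning vectors are S applied to the first legs of degree [n] of one fixed [x] with mu(x)
    nonzero, so the same list serves every [y]. *)
Lemma gr_integral_fd n : exists s : seq H, (forall a, a \in s -> filt n a) /\
  forall y, filt n y -> coinvariant n y -> inspan (lower n) s y.
Proof.
have [_ mud [x [Fx mux]] mu_int] := int_mu.
have [r gr] := grep_exists Fx.
exists [seq S t.1.2 | t <- r & t.1.1 == n]; split.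
  move=> _ /mapP[t + ->]; rewrite mem_filter => /andP[/eqP <- tr].
  by apply: filt_antip => //; have [_ /(_ _ tr)[_ []]] := gr.
move=> y Fy cy; have sI := inspan_sub [seq S t.1.2 | t <- r & t.1.1 == n] (lower_subspace hH n).
apply: (perp_perp sI) => f lf fs.
have fn : kills f (lower n) by move=> z lz; apply/fs/inspan_base => //; apply: lower_subspace.
have := gr_integral_antip Fx gr Fy lf fn.
rewrite cy //; last exact: lin_fun_mull.
rewrite mulr1 big_seq_cond big1 => [/eqP|t /andP[tr tn]].
  by rewrite mulf_eq0 => /orP[/eqP//|/eqP/mux].
rewrite fs ?mulr0 //; apply: inspan_mem; first exact: lower_subspace.
by apply/mapP; exists t => //; rewrite mem_filter tn.
Qed.

End GrIntegral.

End Integrals.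

(** * Passage between the finiteness conditions *)

Section Equivalences.
Variables (k : fieldType) (H : algType k) (hH : hopf H).
Implicit Types (f g lam mu : H -> k) (U D E V M : H -> Prop).

Notation S := (antip hH).
Notation eps := (cou hH).
Notation sw := (sw hH).
Notation L := (Lop hH).
Notation R := (Rop hH).
Notation cop := (cop hH).
Notation corad := (coradical hH).
Notation K := (H0alg hH).
Notation filt := (filt hH).
Notation lower := (lower hH).
Notation coinvariant := (coinvariant hH).

Lemma filt1 n : filt n 1.
Proof. exact: (@filt_le _ _ _ 0 n 1 _ (H0alg1 hH)). Qed.

Lemma coFrobenius_gr_integral : coFrobenius hH -> exists d mu, gr_integral hH d mu.
Proof.
move=> [lam [llam [[x [_ lamx]] lam_int]]].
have llam' : @lin _ H (k^o) lam := llam.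
have ex : exists n, `[< exists x, filt n x /\ lam x <> 0 >].
  by have [n Fx] := filt_exhaustive hH x; exists n; apply/asboolP; exists x.
case: (ex_minnP ex) => d /asboolP dP dmin; exists d, lam; split=> //.
  case: d {dP} dmin => [_ y y0|d dmin y Fy]; first by rewrite (y0 : y = 0); apply: (lin0 llam').
  apply: contrapT => lamy; have : (d.+1 <= d)%N by apply: dmin; apply/asboolP; exists y.
  by rewrite ltnn.
move=> i h f Fh lf fi; rewrite -(f_Lop hH) // [L lam h]lam_int //.
have /= -> := linZ (lf : @lin _ H (k^o) f) (lam h) 1.
(* For i > 0 the functional [f] kills H_[i-1], which contains 1. *)
by case: i fi {Fh} => [//|i] fi; rewrite fi ?scaler0 //; apply: filt1.
Qed.

Lemma gr_integral_gr_coFrobenius d mu : gr_integral hH d mu -> gr_coFrobenius hH.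
Proof.
move=> [lmu mud [x [Fx mux]] mu_int].
exists (fun n => if n == d then mu else fun _ => 0); split; last split; last split.
- by move=> n; case: ifP => _ //; apply: lin_fun_zero.
- by move=> n y ly; case: eqP ly => [->|//]; apply: mud.
- by exists d, x; rewrite eqxx.
move=> n h Fh r gr i lein; apply: (perp_perp (lower_subspace hH i)) => f lf fi.
have lf' : @lin _ H (k^o) f := lf.
have /= -> := linB lf' (\sum_(t <- r | t.1.1 == i) (if (n - i)%N == d then mu else fun _ => 0) t.2 *: t.1.2) _.
have /= -> := lin_bigsum lf' r (fun t => t.1.1 == i)
  (fun t => (if (n - i)%N == d then mu else fun _ => 0) t.2 *: t.1.2).
have -> : f (if i == 0%N then (if n == d then mu else fun _ => 0) h *: 1 else 0) =
          if i == 0%N then (if n == d then mu else fun _ => 0) h * f 1 else 0.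
  by case: ifP => _; [exact: (linZ lf') | exact: (lin0 lf')].
case: (eqVneq (n - i)%N d) => [nid|nid].
  have nE : n = (i + d)%N by rewrite -nid subnKC.
  transitivity (\sum_(t <- r | t.1.1 == i) f t.1.2 * mu t.2 -
    (if i == 0%N then (if n == d then mu else fun _ => 0) h * f 1 else 0)).
    congr (_ - _); apply: eq_bigr => t _.
    have /= -> := linZ lf' (mu t.2) t.1.2; exact: mulrC.
  rewrite (grep_pairing gr lein lf lmu fi) ?nid // (mu_int i h f) -?nE //.
  by case: eqP => [i0|_]; rewrite ?subrr // nE i0 add0n eqxx subrr.
rewrite big1 => [|t _]; last by rewrite scale0r; apply: (lin0 lf').
case: eqP => [i0|_]; last by rewrite subr0.
by move: nid; rewrite i0 subn0 => /negbTE ->; rewrite mul0r subr0.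
Qed.

(** Each homogeneous component of an integral on gr H is again an integral; one that is nonzero is
    selected. *)
Lemma gr_coFrobenius_gr_integral : gr_coFrobenius hH -> exists d mu, gr_integral hH d mu.
Proof.
move=> [lam [llam [lamlow [[d [x [Fx lamx]]] lam_int]]]].
exists d, (lam d); split=> //; first by move=> y; apply: lamlow.
  by exists x.
move=> i h f Fh lf fi; have lf' : @lin _ H (k^o) f := lf.
have [r gr] := grep_exists Fh.
have lein : (i <= i + d)%N := leq_addr d i.
have := fi _ (lam_int _ _ Fh _ gr _ lein).
have /= -> := linB lf' (\sum_(t <- r | t.1.1 == i) lam (i + d - i)%N t.2 *: t.1.2) _.
have /= -> := lin_bigsum lf' r (fun t => t.1.1 == i) (fun t => lam (i + d - i)%N t.2 *: t.1.2).
move/eqP; rewrite subr_eq0 => /eqP e.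
rewrite -(grep_pairing gr lein lf (llam d) fi); last by rewrite addKn => y; apply: lamlow.
transitivity (\sum_(t <- r | t.1.1 == i) f (lam (i + d - i)%N t.2 *: t.1.2)).
  apply: eq_bigr => t _; rewrite addKn; have /= -> := linZ lf' (lam d t.2) t.1.2.
  exact: mulrC.
rewrite e; case: eqP => [->|_]; last exact: (lin0 lf').
by have /= -> := linZ lf' (lam (0 + d)%N h) 1.
Qed.

(** Here a_2 S(a_3) cancels. Read from right to left, multiplication by [a] moves from the argument
    of [f] to [t] and to the argument of [g]. *)
Lemma sw_mul_cancel f g t a : lin_fun f -> lin_fun g ->
  sw (fun b c => ev2 f (fun w => g (w * S c)) (cop (t * b)) : k^o) a =
  ev2 (fun w => f (w * a)) g (cop t).
Proof.
move=> lf lg; have lf' : @lin _ H (k^o) f := lf; have lg' : @lin _ H (k^o) g := lg.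
pose T p q c := sw (fun u v => (f (u * p) * g (v * (q * S c)) : k^o)) t.
transitivity (sw (fun b c => sw (fun p q => T p q c) b) a).
  apply: (@eq_sw _ _ hH (k^o)) => b c; rewrite ev2_sw sw_mul; last by lin_tac.
  rewrite sw_exchange; apply: (@eq_sw _ _ hH (k^o)) => p q.
  by apply: (@eq_sw _ _ hH (k^o)) => u v; rewrite mulrA.
rewrite sw_coassoc; last by rewrite /T; lin_tac.
rewrite ev2_sw.
apply: (sw_counitr (G := fun p => sw (fun u v => (f (u * p) * g v : k^o)) t)) => [|p z].
  by lin_tac.
transitivity (eps z *: sw (fun u v => (f (u * p) * g (v * 1) : k^o)) t); last first.
  by congr (_ *: _); apply: (@eq_sw _ _ hH (k^o)) => u v; rewrite mulr1.
apply: (sw_antipr (G := fun w => sw (fun u v => (f (u * p) * g (v * w) : k^o)) t)) => //.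
by lin_tac.
Qed.

(** The same device, with S(w_2) w_3 cancelling. *)
Lemma sw_antip_cancel f g c w : lin_fun f -> lin_fun g ->
  sw (fun a b => ev2 (fun z => f (z * b)) g (cop (c * S a)) : k^o) w =
  ev2 f (fun z => g (z * S w)) (cop c).
Proof.
move=> lf lg; have lf' : @lin _ H (k^o) f := lf; have lg' : @lin _ H (k^o) g := lg.
pose T p q b := sw (fun u v => (f (u * (S q * b)) * g (v * S p) : k^o)) c.
transitivity (sw (fun a b => sw (fun p q => T p q b) a) w).
  apply: (@eq_sw _ _ hH (k^o)) => a b; rewrite ev2_sw sw_mul; last by lin_tac.
  rewrite [RHS]sw_exchange; apply: (@eq_sw _ _ hH (k^o)) => u v.
  rewrite sw_antip; last by lin_tac.
  by apply: (@eq_sw _ _ hH (k^o)) => p q; rewrite mulrA.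
rewrite sw_coassoc; last by rewrite /T; lin_tac.
rewrite ev2_sw.
apply: (sw_counitr (G := fun p => sw (fun u v => (f u * g (v * S p) : k^o)) c)) => [|p z].
  by lin_tac.
transitivity (eps z *: sw (fun u v => (f (u * 1) * g (v * S p) : k^o)) c); last first.
  by congr (_ *: _); apply: (@eq_sw _ _ hH (k^o)) => u v; rewrite mulr1.
apply: (sw_antipl (G := fun w => sw (fun u v => (f (u * w) * g (v * S p) : k^o)) c)) => //.
by lin_tac.
Qed.

Hypothesis hS : forall x, corad x -> corad (S x).

Lemma filt_finite_coFrobenius : coFrob_sub hH K -> filt_finite hH -> coFrobenius hH.
Proof.
move=> [lam [llam [[a [Ka lama]] lam_int]]] fin.
have ex : exists n, `[< forall h, filt n h >].
  by have [m Fm] := fin; exists m; apply/asboolP.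
case: (ex_minnP ex) => m /asboolP Fm mmin.
have top g x : lin_fun g -> kills g (lower m) -> K (L g x).
  by move=> lg gm; have := filt_perpL lg gm (leqnn m) (Fm x); rewrite subnn.
suff [g [x [lg gm lgx]]] : exists g x, [/\ lin_fun g, kills g (lower m) & lam (L g x) <> 0].
  exists (fun y => lam (L g y)); split; first exact: lin_fun_L.
  split; first by exists x.
  move=> h _; apply: functional_eq => f lf; have lf' : @lin _ H (k^o) f := lf.
  have lL := lin_fun_L hH llam lg.
  transitivity (f (L (fun y => lam (L g y)) h)) => //.
  rewrite [LHS](LR_adj hH) // LR_comm // -[LHS](LR_adj hH) //.
  by rewrite [L lam _]lam_int //; apply: top.
(* If all these integrals vanish, then lam(t_1 b) h(t_2) = 0 also for every [b] in H_[0], by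
   [sw_mul_cancel]; cancelling the antipode gives g(t) lam(a) = 0, whence H lies in [lower m]. *)
apply: contrapT => no.
have lam0 g x : lin_fun g -> kills g (lower m) -> ev2 lam g (cop x) = 0.
  by move=> lg gm; rewrite -f_Lop //; apply: contrapT => lgx; apply: no; exists g, x.
have all_low t : lower m t.
  apply: (perp_perp (lower_subspace hH m)) => g lg gm.
  have lamK b h : K b -> lin_fun h -> kills h (lower m) ->
      ev2 (fun w => lam (w * b)) h (cop t) = 0.
    move=> Kb lh hm; have lh' : @lin _ H (k^o) h := lh; have llam' : @lin _ H (k^o) lam := llam.
    have [r [e rP]] := (filt_subcoalg hH 0).2 b Kb.
    rewrite -sw_mul_cancel // (sw_teq _ e); last first.
      split=> [c|c].
        have : @lin _ H (k^o) (fun b => sw (fun u v => (lam u * h (v * S c) : k^o)) (t * b)) by lin_tac.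
        by [].
      have : @lin _ H (k^o) (fun b => sw (fun u v => (lam u * h (v * S b) : k^o)) (t * c)) by lin_tac.
      by [].
    rewrite big_seq big1 // => p /rP[_ Kp]; apply: lam0.
      by apply: (lin_fun_mulr (S p.2) lh).
    by move=> w lw; apply/hm/lowerMr => //; apply: H0alg_antip.
  have : eps (L g t) * lam a = 0.
    apply: (@coact_antipr _ _ _ hS K lam _ a) => //; last 1 first.
    - move=> b f Kb lf; have lb := lin_fun_mulr b llam.
      rewrite -(f_Lop hH) // L_comp //.
      have /= -> := f_Lop hH (fun z => f (L g z)) t lb; apply: lamK => //.
        exact: lin_fun_L.
      by move=> w lw; rewrite (LR_adj hH) //; apply/gm/lower_R.
    - by move=> x y Kx Ky; apply: H0algM.
    - exact: top.
  by move/eqP; rewrite mulf_eq0 eps_L // => /orP[/eqP//|/eqP].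
(* For m = 0 this says 1 = 0, against the counit; for m > 0 it contradicts the minimality of [m]. *)
case: m {Fm top no lam0} mmin all_low => [_ low|m mmin low].
  by have /eqP := low 1; rewrite -[_ == _]/((1 : H) == 0); move=> /eqP e;
     have := cou_one hH; rewrite e (lin0 (lin_eps hH)) => /eqP; rewrite eq_sym oner_eq0.
have : (m.+1 <= m)%N by apply: mmin; apply/asboolP.
by rewrite ltnn.
Qed.

Lemma corad_pow_H0alg_eq : coFrob_sub hH K -> exists m, forall x, K x <-> corad_pow hH m x.
Proof.
move=> [lam [llam [[t [Kt lamt]] lam_int]]].
have llam' : @lin _ H (k^o) lam := llam.
have [m ct] := H0alg_pow Kt.
exists m.+1 => x; split; last exact: corad_pow_H0alg.
move=> Kx; apply: contrapT => ncx; apply: lamt.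
have rU n : right_coideal hH (corad_pow hH n).
  split; first exact: corad_pow_subspace.
  by move=> f y lf /corad_pow_legs/(legs_LR _ _ (corad_pow_subspace _ _))/(_ f lf)[].
have rK : right_coideal hH K.
  by split; [apply: H0alg_subspace | move=> f y; apply: H0alg_L].
have [M [rM UM nMx Mmax]] := max_right_coideal (rU m.+1) ncx.
have [f [lf fM fx]] := separation rM.1 nMx.
have lf' : @lin _ H (k^o) f := lf.
have cz : corad (R f x).
  by apply: (simple_quotient_coradical rK rM Kx Mmax) => // v _; apply: fM.
(* [starstar] and the integral property turn this into f(S(t_1) b) lam(t_2 y), and S(t_1) b lies in
   H_0^(m+1), which [f] kills. *)
have low y b : K y -> corad b -> ev2 (fun z => f (z * b)) (fun z => lam (t * z)) (cop y) = 0.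
  move=> Ky cb; have lfb := lin_fun_mulr b lf; rewrite -starstar //.
  have [r [e rP]] := corad_pow_legs ct.
  have lfb' : @lin _ H (k^o) (fun z => f (z * b)) := lfb.
  rewrite (sw_teq _ e); last first.
    split=> [c|c].
      have : @lin _ H (k^o) (fun a => sw (fun u v => (f (S a * u * b) * lam v : k^o)) (c * y)) by lin_tac.
      by [].
    have : @lin _ H (k^o) (fun a => sw (fun u v => (f (S c * u * b) * lam v : k^o)) (a * y)) by lin_tac.
    by [].
  rewrite big_seq big1 // => p /rP[cp1 cp2].
  have lF : lin_fun (fun z => f (S p.1 * z * b)) by apply: (lin_fun_mull (S p.1) lfb).
  rewrite -(f_Lop hH) // [L lam _]lam_int; last first.
    by apply: H0algM => //; apply: corad_pow_H0alg cp2.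
  rewrite (linZ (lF : @lin _ H (k^o) _)) mulr1 fM ?scaler0 //; apply: UM.
  rewrite -addn1; apply: corad_powM; last exact: corad_pow1.
  exact: corad_pow_antip.
(* Expanding by [sw_antip_cancel] gives instances of [low] at y = c S(w_1) and b = w_2. *)
have lamRS c w : K c -> corad w -> lam (t * (R f c * S w)) = 0.
  move=> Kc cw.
  have lg : lin_fun (fun z => lam (t * z)) by apply: lin_fun_mull.
  have lgw : lin_fun (fun z => lam (t * (z * S w))) by apply: (lin_fun_mulr (S w) lg).
  have /= -> := f_Rop hH f c lgw.
  have lg' : @lin _ H (k^o) (fun z => lam (t * z)) := lg.
  rewrite -(sw_antip_cancel c w lf lg).
  have [r [e rP]] := (coradical_subcoalg hH).2 w cw.
  rewrite (sw_teq _ e); last first.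
    split=> [b|b].
      have : @lin _ H (k^o) (fun a => sw (fun u v => (f (u * b) * lam (t * v) : k^o)) (c * S a)) by lin_tac.
      by [].
    have : @lin _ H (k^o) (fun a => sw (fun u v => (f (u * a) * lam (t * v) : k^o)) (c * S b)) by lin_tac.
    by [].
  rewrite big_seq big1 // => p /rP[cp1 cp2]; apply: low => //.
  apply: H0algM => //; apply: (@corad_pow_H0alg _ _ _ 1).
  by apply/corad_pow1/hS.
(* For z = [R f x], of counit 1, lam(t) = lam(t z_1 S(z_2)). The second legs are taken in H_0 and
   the first legs have the form [R f c] with [c] in H_[0], as [lamRS] requires. *)
have := @sw_antipr _ _ hH (k^o) (fun w => lam (t * w)) _ (R f x) _ (fun _ _ => erefl).
rewrite mulr1 eps_R // fx /GRing.scale /= mul1r => <-; last by lin_tac.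
have [g lg|r [e rP]] := @tens_adaptL k H corad (cop (R f x)) (coradical_subspace hH).
  by have [] := coradical_LR lg cz.
rewrite (sw_teq _ e); last by lin_tac.
rewrite big_seq big1 // => p /rP[cp [g [lg ->]]].
rewrite -[Lr g _]/(L g (R f x)) LR_comm //; apply: lamRS => //.
exact: H0alg_L.
Qed.

Lemma filt_stable_finite N : (forall n y, (N <= n)%N -> filt n y -> lower n y) -> filt_finite hH.
Proof.
move=> stab; exists N => x; have [n Fx] := filt_exhaustive hH x.
have [led|] := leqP n N; first exact: (filt_le led).
elim: n Fx => // n IH Fx; rewrite ltnS => ledn.
have Fn : filt n x := stab n.+1 x (leqW ledn) Fx.
by move: ledn; rewrite leq_eqVlt => /orP[/eqP->//|]; apply: IH.
Qed.

Lemma fg_filt_finite : fg_left_H0 hH -> filt_finite hH.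
Proof.
move=> [s sP].
have [n nP] : exists n, forall x, x \in s -> filt n x.
  elim: s {sP} => [|x t [n nP]]; first by exists 0.
  have [m Fx] := filt_exhaustive hH x.
  exists (maxn n m) => y; rewrite inE => /orP[/eqP->|yt].
    by apply: filt_le Fx; apply: leq_maxr.
  by apply: filt_le (nP _ yt); apply: leq_maxl.
exists n => h; have [c [cP ->]] := sP h; apply: sub_sum => [|p /cP[K1 s2] _].
  exact: filt_subspace.
by apply: (@filtM _ _ _ 0) => //; apply: nP.
Qed.

(** The sum in [in_diagram] does not depend on the graded representation, by [grep_pairing]. *)
Lemma in_diagramP (g : nat -> H) : gr_elt hH g ->
  (in_diagram hH g <-> forall n, coinvariant n (g n)).
Proof.
move=> eg; split=> [[_ dg] n f f' lf lf' fn|cg].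
  have [r gr] := grep_exists (eg.1 n).
  rewrite -(dg n r gr f f' lf lf' fn) (grep_pairing gr (leqnn n)) //.
  by rewrite subnn => z z0; rewrite (z0 : z = 0); apply: (lin0 (lf' : @lin _ H (k^o) _)).
split=> // n r gr f f' lf lf' fn; rewrite -cg // (grep_pairing gr (leqnn n)) //.
by rewrite subnn => z z0; rewrite (z0 : z = 0); apply: (lin0 (lf' : @lin _ H (k^o) _)).
Qed.

Lemma coinvariant_subspace n : subspace (coinvariant n).
Proof.
split.
  move=> f g lf lg fn; rewrite ev2_sw (lin0 (lin_sw hH (bilin_ev lf lg))).
  by have /= -> := lin0 (lf : @lin _ H (k^o) _); rewrite mul0r.
move=> a x y cx cy f g lf lg fn; rewrite ev2_sw (lin_sw hH (bilin_ev lf lg)) -!ev2_sw.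
by rewrite cx // cy // lf mulrDl -mulrA.
Qed.

Definition homogeneous (n : nat) (y : H) (j : nat) : H := if j == n then y else 0.

Lemma homogeneous_diagram n y : filt n y -> coinvariant n y -> in_diagram hH (homogeneous n y).
Proof.
move=> Fy cy; apply/in_diagramP => [|j].
  split=> [j|]; first by rewrite /homogeneous; case: eqP => [->//|_]; apply: sub0 (filt_subspace hH j).
  by exists n.+1 => j ltnj; rewrite /homogeneous gtn_eqF.
by rewrite /homogeneous; case: eqP => [->//|_]; apply: (coinvariant_subspace j).1.
Qed.

(** The finitely many spanning families vanish from a common degree [N] on, so there all
    coinvariants are zero modulo [lower n]; by [coinvariant_all] the filtration is then
    stationary. *)
Lemma diagram_filt_finite : diagram_findim hH -> filt_finite hH.
Proof.
move=> [s [sP span]].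
have [N NP] : exists N, forall i n, (i < size s)%N -> (N <= n)%N -> nth (fun _ => 0) s i n = 0.
  elim: s sP {span} => [|g s IH] sP; first by exists 0.
  have [|N NP] := IH; first by move=> i; apply: (sP i.+1).
  have [[_ [M MP]] _] := sP 0 isT.
  exists (maxn N M) => -[|i] n /= lti; rewrite geq_max => /andP[? ?]; first exact: MP.
  exact: NP.
apply: (@filt_stable_finite N) => n y leNn; apply: coinvariant_all => // p Fp cp.
have [c cP] := span _ (homogeneous_diagram Fp cp).
have := cP n; rewrite /homogeneous eqxx big1 ?subr0 // => i _.
by rewrite NP ?scaler0.
Qed.

Section GrIntegral.
Variables (d : nat) (mu : H -> k).
Hypothesis int_mu : gr_integral hH d mu.

Let rspan (s : seq H) y := exists c : seq (H * H),
  (forall p, p \in c -> p.1 \in s /\ K p.2) /\ y = \sum_(p <- c) p.1 * p.2.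

(** Coinvariants times H_[0] span H_[n] over H_[n-1], which gives finitely many right generators of
    H = H_[d]. As S is onto, reverses products and maps H_[0] to itself, their images under S are
    left generators. *)
Lemma gr_integral_fg : fg_left_H0 hH.
Proof.
have srspan s : subspace (rspan s).
  split; first by exists [::]; rewrite big_nil.
  move=> a _ _ [c [cP ->]] [c' [c'P ->]].
  exists ([seq (p.1, a *: p.2) | p <- c] ++ c'); split.
    move=> p; rewrite mem_cat => /orP[/mapP[q /cP[? ?] ->]|/c'P//]; split=> //.
    by apply: subZ => //; apply: H0alg_subspace.
  rewrite big_cat big_map scaler_sumr; congr (_ + _).
  by apply: eq_bigr => p _; rewrite scalerAr.
have step n s : (forall y, lower n y -> rspan s y) ->
    exists s', forall y, filt n y -> rspan s' y.
  move=> lows; have [s0 [_ s0P]] := gr_integral_fd hS int_mu n.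
  exists (s0 ++ s) => y Fy; apply: (perp_perp (srspan _)) => f lf fs.
  have low y' : lower n y' -> rspan (s0 ++ s) y'.
    move=> /lows[c [cP ->]]; exists c; split=> // p /cP[ps ?].
    by rewrite mem_cat ps orbT.
  apply: (coinvariant_span hS lf _ _ Fy) => [z /low/fs//|p c Fp cp Kc].
  apply: fs; move: (s0P _ Fp cp).
  apply: (@inspan_min _ _ (lower n) s0 (fun p => rspan (s0 ++ s) (p * c))).
  - split; first by rewrite mul0r; apply: sub0.
    by move=> a u v ru rv; rewrite mulrDl -scalerAl; apply: (srspan _).2.
  - by move=> u lu; apply/low/lowerMr.
  - move=> u us; exists [:: (u, c)]; rewrite big_seq1; split=> // q /[!inE] /eqP->.
    by rewrite mem_cat us.
have all n : exists s, forall y, filt n y -> rspan s y.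
  elim: n => [|n [s sP]]; last exact: (step n.+1 s).
  by apply: (step 0 [::]) => y y0; rewrite (y0 : y = 0); apply: sub0.
have [s sP] := all d; exists [seq S a | a <- s] => h.
have [x ->] := gr_integral_antip_onto hS int_mu h.
have [c [cP ->]] := sP x (gr_integral_filt_all hS int_mu x).
exists [seq (S p.2, S p.1) | p <- c]; split.
  move=> _ /mapP[p /cP[ps Kp] ->] /=; split; first exact: H0alg_antip.
  by apply/mapP; exists p.1.
rewrite (lin_bigsum (lin_antip hH)) big_map; apply: eq_bigr => p _.
by rewrite antipM.
Qed.

(** The lists of [gr_integral_fd] are not known to consist of coinvariants; [inspan_refine] replaces
    them by lists that do, one degree at a time. Degrees above [d] contribute nothing because H =
    H_[d]. *)
Lemma gr_integral_diagram : diagram_findim hH.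
Proof.
have inspan_sum (B : H -> Prop) (s : seq H) u : inspan B s u ->
    exists c : nat -> k, B (u - \sum_(i < size s) c i *: nth 0 s i).
  elim: s u => [|v s IH] u /=; first by move=> Bu; exists (fun _ => 0); rewrite big_ord0 subr0.
  move=> [a /IH[c Bc]]; exists (fun i => if i is j.+1 then c j else a).
  by rewrite big_ord_recl /= opprD addrA.
have main N : exists s : seq (nat -> H),
    (forall i, (i < size s)%N -> in_diagram hH (nth (fun _ => 0) s i)) /\
    forall g : nat -> H, in_diagram hH g -> exists c : nat -> k, forall n, (n < N)%N ->
      lower n (g n - \sum_(i < size s) c i *: nth (fun _ => 0) s i n).
  elim: N => [|N [s [sP span]]]; first by exists [::]; split=> // g _; exists (fun _ => 0).
  have [t [_ tP]] := gr_integral_fd hS int_mu N.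
  have [|u|s1 [s1P s1span]] := @inspan_refine _ _ (lower N) t
      (fun y => filt N y /\ coinvariant N y) (lower_subspace hH N).
  - by apply: subspaceI; [apply: filt_subspace | apply: coinvariant_subspace].
  - by move=> [? ?]; apply: tP.
  exists (s ++ [seq homogeneous N u | u <- s1]); split.
    move=> i; rewrite size_cat size_map nth_cat => lti; case: ltnP => [|les]; first exact: sP.
    have lti' : (i - size s < size s1)%N by rewrite ltn_subLR.
    rewrite (nth_map 0) //; have [? ?] := s1P _ (mem_nth 0 lti').
    exact: homogeneous_diagram.
  move=> g dg; have [c cP] := span g dg.
  have cdg : forall n, coinvariant n (g n) by apply/in_diagramP => //; case: dg.
  (* The remainder in degree [N] after the old generators. It is coinvariant, so the new homogeneous
     generators absorb it without disturbing lower degrees. *)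
  pose y := g N - \sum_(i < size s) c i *: nth (fun _ => 0) s i N.
  have [Fy cy] : filt N y /\ coinvariant N y.
    split.
      apply: (subB (filt_subspace hH N)); first by case: dg => -[].
      apply: (sub_sum (filt_subspace hH N)) => i _ _.
      by apply: (subZ _ (filt_subspace hH N)); have [[]] := sP i (ltn_ord i).
    apply: (subB (coinvariant_subspace N)); first exact: cdg.
    apply: (sub_sum (coinvariant_subspace N)) => i _ _.
    apply: (subZ _ (coinvariant_subspace N)).
    by have di := sP i (ltn_ord i); apply: (in_diagramP di.1).1.
  have [c1 c1P] := inspan_sum _ _ _ (s1span y (conj Fy cy)).
  exists (fun i => if (i < size s)%N then c i else c1 (i - size s)%N) => n.
  rewrite ltnS leq_eqVlt size_cat size_map big_split_ord /=.
  have -> : \sum_(i < size s) (if (i < size s)%N then c i else c1 (i - size s)%N) *: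
      nth (fun _ => 0) (s ++ [seq homogeneous N u | u <- s1]) i n =
      \sum_(i < size s) c i *: nth (fun _ => 0) s i n.
    by apply: eq_bigr => i _; rewrite nth_cat ltn_ord.
  have -> : \sum_(i < size s1) (if (size s + i < size s)%N then c (size s + i)%N
        else c1 (size s + i - size s)%N) *:
      nth (fun _ => 0) (s ++ [seq homogeneous N u | u <- s1]) (size s + i)%N n =
      \sum_(i < size s1) c1 i *: homogeneous N (nth 0 s1 i) n.
    apply: eq_bigr => i _; rewrite nth_cat ltnNge leq_addr /= addKn.
    by rewrite (nth_map 0).
  rewrite opprD addrA => /orP[/eqP nN|ltn].
    by rewrite nN -/y; move: c1P; congr (lower _ (_ - _)); apply: eq_bigr => i _;
       rewrite /homogeneous eqxx.
  rewrite [X in _ - X]big1 ?subr0; first exact: cP.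
  by move=> i _; rewrite /homogeneous ltn_eqF // scaler0.
have [s [sP span]] := main d.+1; exists s; split=> // g dg.
have [c cP] := span g dg; exists c => n.
have [ledn|ltdn] := leqP n d; first exact: cP.
by apply: (filt_lower ltdn); apply: (gr_integral_filt_all hS int_mu).
Qed.

End GrIntegral.

End Equivalences.

Theorem theorem2p6 (k : fieldType) (H : algType k) (hH : hopf H) :
  (forall x, coradical hH x -> coradical hH (antip hH x)) ->
  ((coFrobenius hH <-> coFrob_sub hH (H0alg hH) /\ fg_left_H0 hH) /\
   (coFrobenius hH <-> coFrob_sub hH (H0alg hH) /\ filt_finite hH) /\
   (coFrobenius hH <-> gr_coFrobenius hH) /\
   (coFrobenius hH <-> coFrob_sub hH (H0alg hH) /\ diagram_findim hH)) /\
  (coFrob_sub hH (H0alg hH) ->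
     exists m, forall x, H0alg hH x <-> corad_pow hH m x).
Proof.
move=> hS.
have fin_coFrob := filt_finite_coFrobenius hS.
(* A homogeneous integral of gr H yields every finiteness condition; the way back to (i) always
   passes through finiteness of the filtration. *)
have all d mu : gr_integral hH d mu ->
    [/\ coFrob_sub hH (H0alg hH), fg_left_H0 hH, filt_finite hH & diagram_findim hH].
  move=> im; split.
  - exact: (gr_integral_coFrob_H0alg hS im).
  - exact: (gr_integral_fg hS im).
  - by exists d; apply: (gr_integral_filt_all hS im).
  - exact: (gr_integral_diagram hS im).
split; last exact: corad_pow_H0alg_eq.
split; [|split; [|split]]; split.
- by move=> /coFrobenius_gr_integral[d [mu /all[]]].
- by move=> [coK /fg_filt_finite]; apply: fin_coFrob.
- by move=> /coFrobenius_gr_integral[d [mu /all[]]].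
- by move=> []; apply: fin_coFrob.
- by move=> /coFrobenius_gr_integral[d [mu /gr_integral_gr_coFrobenius]].
- by move=> /gr_coFrobenius_gr_integral[d [mu /all[coK _ fin _]]]; apply: fin_coFrob.
- by move=> /coFrobenius_gr_integral[d [mu /all[]]].
- by move=> [coK /(diagram_filt_finite hS)]; apply: fin_coFrob.
Qed.
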